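(* Let $q$ be a power of a prime $p$ and let $h(x) = x^{10} + a_1x^9 + a_2x^8 + a_3x^7 + a_4x^6 + a_5x^5 + a_4qx^4 + a_3q^2x^3 + a_2q^3x^2 + a_1q^4x + q^5$ with $a_1,\dots,a_5 \in \mathbb{Z}$. Define $u_2 = -\frac{3a_1^2}{25} + \frac{3a_2}{10} - \frac{3q}{2}$, $u_3 = \frac{2a_1^3}{125} - \frac{3a_1a_2}{50} - \frac{qa_1}{10} + \frac{a_3}{10}$, $u_4 = -\frac{3a_1^4}{625} + \frac{3a_1^2a_2}{125} + \frac{qa_1^2}{5} - \frac{2a_1a_3}{25} - \frac{3qa_2}{5} + \frac{a_4}{5} + q^2$, $\Delta = u_3^2 + \frac{4}{27}u_2^3$, and $S = \left\{ -\zeta^k\omega\left(\frac{9u_3}{2} + \frac{3\sqrt{\Delta}}{2}\right) - \zeta^{-k}\bar\omega\left(\frac{9u_3}{2} - \frac{3\sqrt{\Delta}}{2}\right) + \frac{2u_2^2}{3} : 0 \leq k \leq 2\right\}$, where $\zeta$ is a primitive third root of unity, $\sqrt{\Delta}$ a complex square root of $\Delta$ and $\omega$ a complex third root of $\frac12(-u_3 + \sqrt{\Delta})$. Consider: (a) $|a_1| \leq 10\sqrt{q}$; (b* ) $8\sqrt{q}\,|a_1| - 35q \leq a_2$; (b) $a_2 \leq \frac25 a_1^2 + 5q$; (c) $-\frac{4}{25}a_1^3 + \frac35 a_1a_2 + qa_1 - \frac{1}{50}(4a_1^2 + 50q - 10a_2)^{3/2} \leq a_3 \leq -\frac{4}{25}a_1^3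 + \frac35 a_1a_2 + qa_1 + \frac{1}{50}(4a_1^2 + 50q - 10a_2)^{3/2}$ (the quantity $4a_1^2+50q-10a_2$ is a non-negative real by (b)); (d) $-6\sqrt{q}\,a_2 - 20qa_1 - 50q\sqrt{q} \leq a_3 \leq 6\sqrt{q}\,a_2 - 20qa_1 + 50q\sqrt{q}$. If $h(x) \in W_q(5)$ or (a)–(d) hold, then the elements of $S$ are real numbers $\theta_1 \leq \theta_2 \leq \theta_3$. Consider further: (e) $\frac{3a_1^4}{125} - \frac{3a_1^2a_2}{25} - qa_1^2 + \frac{2a_1a_3}{5} + 3qa_2 - 5q^2 + 5\theta_1 \leq a_4 \leq \frac{3a_1^4}{125} - \frac{3a_1^2a_2}{25} - qa_1^2 + \frac{2a_1a_3}{5} + 3qa_2 - 5q^2 + 5\theta_2$; (f) $4\sqrt{q}\,|4qa_1 + a_3| - 9qa_2 - 25q^2 \leq a_4$; (g) $-2\sqrt{q}\,a_4 - 2qa_3 - 2q\sqrt{q}\,a_2 - 2q^2a_1 - 2q^2\sqrt{q} \leq a_5 \leq 2\sqrt{q}\,a_4 - 2qa_3 + 2q\sqrt{q}\,a_2 - 2q^2a_1 + 2q^2\sqrt{q}$. If $u_3 = 0$, for $i_1,i_2 \in \{+1,-1\}$ set $x_{i_1,i_2} = i_1\sqrt{-u_2 + i_2\sqrt{u_2^2 - u_4}}$. If $u_3 \neq 0$, set $v_2 = -\frac{u_2^2}{3} - u_4$, $v_3 = \frac{2u_2u_4}{3} - \frac{2u_2^3}{27} - 2u_3^2$, let $C$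 be a complex third root of $-v_3$ if $v_2 = 0$ and of $\frac12\left(-v_3 + \sqrt{v_3^2 + \frac{4}{27}v_2^3}\right)$ if $v_2 \neq 0$, let $y = C - \frac{v_2}{3C} - \frac{2u_2}{3}$, and set $x_{i_1,i_2} = \frac{i_1\sqrt{2y} + i_2\sqrt{-4u_2 - 2y - i_1\frac{8u_3}{\sqrt{2y}}}}{2}$. If $h(x) \in W_q(5)$ or (a)–(f) hold, then the four elements $x_{i_1,i_2}$ are real numbers $\gamma_1 \leq \gamma_2 \leq \gamma_3 \leq \gamma_4$; using them define $\Lambda_1 = \max\{H(\gamma_1),H(\gamma_3)\}$ and $\Lambda_2 = \min\{H(\gamma_2),H(\gamma_4)\}$, where $H(x) = -x^5 - \frac{10}{3}u_2x^3 - 10u_3x^2 - 5u_4x$, and let $A = -\frac{4a_1^5}{3125} + \frac{a_1^3(a_2 + 15q)}{125} - \frac{a_1^2a_3}{25} - \frac{a_1(3a_2q - a_4 + 5q^2)}{5} + 2qa_3$. Consider finally (h) $\Lambda_1 + A \leq a_5 \leq \Lambda_2 + A$. Then $h(x) \in W_q(5)$ if and only if (a)–(h) all hold. Moreover, $h(x) \in W_q(5)$ has a real root if and only if at least one of the inequalities in (a), (b* ), (d), (f) or (g) is an equality. Explicitly, $h(x)$ lies in $W_q(5)$ and has a real root if and only if exactly one of the following (mutually exclusive) cases occurs: (I) $q$ is a square and $h(x) = (x+\sqrt{q})^2h_0(x)$ or $h(x) = (x-\sqrt{q})^2h_0(x)$ with $h_0(x) \in W_q(4)$; (II) $q$ is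 not a square and $h(x) = (x^2-q)^2h_0(x)$ with $h_0(x) \in W_q(3)$.
   Context: A $q$-Weil polynomial is a monic polynomial in $\mathbb{Z}[x]$ of even positive degree $2g$ whose set of complex roots has the form $\{w_1,\bar w_1,\ldots,w_g,\bar w_g\}$ with $|w_i| = \sqrt{q}$ for every $i$. $W_q(g)$ denotes the set of $q$-Weil polynomials of degree $2g$. For a positive real $r$, $r^{1/n}$ and $\sqrt[n]{r}$ denote the positive real $n$-th root; in all other cases these symbols denote an arbitrary complex $n$-th root. *)

(* Defs.v *)
(* complex numbers are the algebraic complex numbers algC
   (all quantities involved are algebraic). *)
From mathcomp Require Import all_boot all_order all_algebra all_field.
Set Implicit Arguments. Unset Strict Implicit. Unset Printing Implicit Defensive.
Import Order.TTheory GRing.Theory Num.Theory.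
Local Open Scope ring_scope.

(* Root convention of the paper: z is an n-th root of r; if r is a positive
   real, z must be the positive real n-th root. *)
Definition rootc (n : nat) (r z : algC) : Prop :=
  z ^+ n = r /\ (0 < r -> 0 < z).

(* q-Weil polynomials of degree 2g *)
Definition Weil (q g : nat) (P : {poly int}) : Prop :=
  P \is monic /\ size P = (2 * g).+1 /\
  exists w : seq algC, size w = g /\
    (forall z, z \in w -> `|z| = sqrtC (q%:R)) /\
    map_poly (fun c : int => c%:~R) P =
      \prod_(z <- w) (('X - z%:P) * ('X - (z^*)%:P)).

Definition hpoly (q : nat) (a1 a2 a3 a4 a5 : int) : {poly int} :=
  let Q : int := q%:Z in
  Poly [:: Q ^+ 5; a1 * Q ^+ 4; a2 * Q ^+ 3; a3 * Q ^+ 2; a4 * Q; a5;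
           a4; a3; a2; a1; 1].

(* The data (q, a1, ..., a5) viewed in algC *)
Record coefs := Coefs { cq : algC; c1 : algC; c2 : algC; c3 : algC;
                        c4 : algC; c5 : algC }.

Section Quantities.
Variable c : coefs.
Local Notation q := (cq c).
Local Notation a1 := (c1 c).
Local Notation a2 := (c2 c).
Local Notation a3 := (c3 c).
Local Notation a4 := (c4 c).
Local Notation a5 := (c5 c).

Definition sq := sqrtC q.

Definition u2 := - (3 * a1 ^+ 2) / 25 + 3 * a2 / 10 - 3 * q / 2.
Definition u3 := 2 * a1 ^+ 3 / 125 - 3 * a1 * a2 / 50 - q * a1 / 10 + a3 / 10.
Definition u4 := - (3 * a1 ^+ 4) / 625 + 3 * a1 ^+ 2 * a2 / 125
  + q * a1 ^+ 2 / 5 - 2 * a1 * a3 / 25 - 3 * q * a2 / 5 + a4 / 5 + q ^+ 2.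
Definition Delta := u3 ^+ 2 + 4 / 27 * u2 ^+ 3.

(* the list of the three elements of S for given choices zeta, sqrt(Delta), omega *)
Definition S_vals (zeta sD om : algC) : seq algC :=
  [seq - zeta ^+ k * om * (9 * u3 / 2 + 3 * sD / 2)
       - zeta ^- k * om^* * (9 * u3 / 2 - 3 * sD / 2) + 2 * u2 ^+ 2 / 3
  | k <- iota 0 3].

(* s is the list of elements of S for some admissible choice *)
Definition S_ok (s : seq algC) : Prop :=
  exists zeta sD om,
    3.-primitive_root zeta /\ rootc 2 Delta sD /\
    om ^+ 3 = (- u3 + sD) / 2 /\ s = S_vals zeta sD om.

Definition cond_a : Prop := `|a1| <= 10 * sq.
Definition cond_bs : Prop := 8 * sq * `|a1| - 35 * q <= a2.
Definition cond_b : Prop := a2 <= 2 / 5 * a1 ^+ 2 + 5 * q.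
Definition c_mid := - (4 / 25) * a1 ^+ 3 + 3 / 5 * a1 * a2 + q * a1.
Definition c_rad := (sqrtC (4 * a1 ^+ 2 + 50 * q - 10 * a2)) ^+ 3 / 50.
Definition cond_c : Prop := c_mid - c_rad <= a3 <= c_mid + c_rad.
Definition d_low := - 6 * sq * a2 - 20 * q * a1 - 50 * q * sq.
Definition d_up := 6 * sq * a2 - 20 * q * a1 + 50 * q * sq.
Definition cond_d : Prop := d_low <= a3 <= d_up.

Definition e_base := 3 * a1 ^+ 4 / 125 - 3 * a1 ^+ 2 * a2 / 25 - q * a1 ^+ 2
  + 2 * a1 * a3 / 5 + 3 * q * a2 - 5 * q ^+ 2.
(* theta_1 <= theta_2 <= theta_3 are the sorted elements of S *)
Definition cond_e : Prop :=
  forall s, S_ok s ->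
    let th := sort <=%R s in
    e_base + 5 * th`_0 <= a4 <= e_base + 5 * th`_1.

Definition f_low := 4 * sq * `|4 * q * a1 + a3| - 9 * q * a2 - 25 * q ^+ 2.
Definition cond_f : Prop := f_low <= a4.

Definition g_low := - 2 * sq * a4 - 2 * q * a3 - 2 * q * sq * a2
  - 2 * q ^+ 2 * a1 - 2 * q ^+ 2 * sq.
Definition g_up := 2 * sq * a4 - 2 * q * a3 + 2 * q * sq * a2
  - 2 * q ^+ 2 * a1 + 2 * q ^+ 2 * sq.
Definition cond_g : Prop := g_low <= a5 <= g_up.

Definition v2 := - (u2 ^+ 2) / 3 - u4.
Definition v3 := 2 * u2 * u4 / 3 - 2 * u2 ^+ 3 / 27 - 2 * u3 ^+ 2.

(* xs is the list [x_{1,1}; x_{1,-1}; x_{-1,1}; x_{-1,-1}] for some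
   admissible choice of the roots *)
Definition X_ok (xs : seq algC) : Prop :=
  if u3 == 0 then
    exists s0 s1 s2,
      rootc 2 (u2 ^+ 2 - u4) s0 /\ rootc 2 (- u2 + s0) s1 /\
      rootc 2 (- u2 - s0) s2 /\ xs = [:: s1; s2; - s1; - s2]
  else
    exists sD C t r1 r2,
      (if v2 == 0 then C ^+ 3 = - v3
       else rootc 2 (v3 ^+ 2 + 4 / 27 * v2 ^+ 3) sD /\
            C ^+ 3 = (- v3 + sD) / 2) /\
      let y := C - v2 / (3 * C) - 2 * u2 / 3 in
      rootc 2 (2 * y) t /\
      rootc 2 (- 4 * u2 - 2 * y - 8 * u3 / t) r1 /\
      rootc 2 (- 4 * u2 - 2 * y + 8 * u3 / t) r2 /\
      xs = [:: (t + r1) / 2; (t - r1) / 2; (- t + r2) / 2; (- t - r2) / 2].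

Definition Hf (x : algC) :=
  - x ^+ 5 - 10 / 3 * u2 * x ^+ 3 - 10 * u3 * x ^+ 2 - 5 * u4 * x.

Definition Aval := - (4 * a1 ^+ 5) / 3125 + a1 ^+ 3 * (a2 + 15 * q) / 125
  - a1 ^+ 2 * a3 / 25 - a1 * (3 * a2 * q - a4 + 5 * q ^+ 2) / 5 + 2 * q * a3.

(* gamma_1 <= ... <= gamma_4 are the sorted x_{i1,i2} *)
Definition cond_h : Prop :=
  forall xs, X_ok xs ->
    let g := sort <=%R xs in
    let L1 := Num.max (Hf g`_0) (Hf g`_2) in
    let L2 := Num.min (Hf g`_1) (Hf g`_3) in
    L1 + Aval <= a5 <= L2 + Aval.

End Quantities.

(* Versions with q : nat and a_i : int, cast into algC *)
Section Casts.
Variables (q : nat) (a1 a2 a3 a4 a5 : int).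
Let C := Coefs q%:R a1%:~R a2%:~R a3%:~R a4%:~R a5%:~R.
Let Q : algC := q%:R.
Let A1 : algC := a1%:~R.
Let A2 : algC := a2%:~R.
Let A3 : algC := a3%:~R.
Let A4 : algC := a4%:~R.
Let A5 : algC := a5%:~R.

(* (a), (b-star), (b), (c), (d) *)
Definition conds_ad : Prop :=
  cond_a C /\ cond_bs C /\
  cond_b C /\ cond_c C /\
  cond_d C.
(* (a) -- (f) *)
Definition conds_af : Prop :=
  conds_ad /\ cond_e C /\ cond_f C.
(* (a) -- (h) *)
Definition conds_ah : Prop :=
  conds_af /\ cond_g C /\ cond_h C.

Definition S_all_real : Prop :=
  forall s, S_ok C s -> forall x, x \in s -> x \is Num.real.
Definition X_all_real : Prop :=
  forall xs, X_ok C xs -> forall x, x \in xs -> x \is Num.real.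

(* one of the inequalities in (a), (b-star), (d), (f), (g) is an equality *)
Definition some_equality : Prop :=
  `|A1| = 10 * sq C \/
  8 * sq C * `|A1| - 35 * Q = A2 \/
  d_low C = A3 \/ A3 = d_up C \/
  f_low C = A4 \/
  g_low C = A5 \/ A5 = g_up C.
End Casts.

Definition has_real_root (P : {poly int}) : Prop :=
  exists x : algC, x \is Num.real /\ root (map_poly (fun c : int => c%:~R) P) x.

Definition is_square (q : nat) : Prop := exists m : nat, q = (m ^ 2)%N.

Definition caseI (q : nat) (h : {poly int}) : Prop :=
  exists m : nat, q = (m ^ 2)%N /\
    exists h0 : {poly int}, Weil q 4 h0 /\
      (h = ('X + (m%:Z)%:P) ^+ 2 * h0 \/ h = ('X - (m%:Z)%:P) ^+ 2 * h0).

Definition caseII (q : nat) (h : {poly int}) : Prop :=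
  ~ is_square q /\
    exists h0 : {poly int}, Weil q 3 h0 /\ h = ('X ^+ 2 - (q%:Z)%:P) ^+ 2 * h0.

(* Main.v *)
(* Dividing h by x^5 and writing y = x + q/x turns h into a quintic f, and h is
   a q-Weil polynomial iff all five roots of f are real and lie in
   [-2 sqrt q, 2 sqrt q].

   Let F be f translated to have no quartic term, G = F'/5 and T = G'/4. If a
   polynomial is real-rooted then so is its derivative (Gauss-Lucas), and by
   Laguerre's inequality P P'' < P'^2 its values at the sorted critical points
   alternate in sign. Conversely, if P had those signs and a nonreal root z,
   the cofactor R of (X - z)(X - conj z) would have the same signs, so that the
   divided difference of R at the critical points, which is the leading
   coefficient 1, would be a sum of nonpositive terms; coinciding critical
   points are excluded by counting multiplicities. Hence the real-rootedness
   of T, G and F amounts successively to (b) and (c), (e), and (h): the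
   elements of S are the numbers theta such that u_4 - theta is the value of
   G at a root of T, and the x_(i1,i2) are the roots of G, by Ferrari's
   formula.

   For a real-rooted f the bound on the roots says that the Taylor coefficients
   of f at 2 sqrt q, and likewise of - f(-x), are nonnegative, which is (a),
   (b-star), (d), (f), (g); as they are the elementary symmetric functions of
   the numbers 2 sqrt q -/+ y, one of them vanishes iff some root is
   2 sqrt q or - 2 sqrt q. *)
Require Import Defs.
From mathcomp Require Import all_boot all_order all_algebra all_field.
From mathcomp Require Import ring.
Import Order.TTheory GRing.Theory Num.Theory.
Local Open Scope ring_scope.
Set Implicit Arguments.
Unset Strict Implicit.
Unset Printing Implicit Defensive.

(** * Real-rooted polynomials *)

Lemma addr_le0 (R : numDomainType) (x y : R) : x <= 0 -> y <= 0 -> x + y <= 0.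
Proof. by move=> x0 y0; rewrite -(addr0 0) lerD. Qed.

Section RealRooted.
Variable C : numClosedFieldType.
Implicit Types (P : {poly C}) (rs : seq C).

Definition real_rooted P := forall z, root P z -> z \is Num.real.

Lemma real_rooted_prod rs : all (mem Num.real) rs ->
  real_rooted (\prod_(r <- rs) ('X - r%:P)).
Proof. by move=> /allP rsR z; rewrite root_prod_XsubC => /rsR. Qed.

Lemma monic_splits P : P \is monic ->
  {rs : seq C | P = \prod_(r <- rs) ('X - r%:P)}.
Proof.
move=> /monicP P1; have [rs Prs] := closed_field_poly_normal P.
by exists rs; rewrite {1}Prs P1 scale1r.
Qed.

Lemma real_rooted_splits P : P \is monic -> real_rooted P ->
  {rs : seq C | all (mem Num.real) rs & P = \prod_(r <- rs) ('X - r%:P)}.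
Proof.
move=> /monic_splits[rs ->] Preal; exists rs => //.
by apply/allP=> r rs_r; apply: Preal; rewrite root_prod_XsubC.
Qed.

(** In P'/P = sum of 1/(z - r) every term has an imaginary part of sign opposite to that of z.
    Multiplying by |P(z)|^2 avoids the division, and the list is nonempty so that the sign is
    strict. *)
Lemma Im_logderiv_lt0 r rs z :
    all (mem Num.real) (r :: rs) -> z \isn't Num.real ->
  let P := \prod_(r <- r :: rs) ('X - r%:P) in
  'Im z * 'Im (P^`().[z] * P.[z]^*) < 0.
Proof.
have ImNl (x y : C) : 'Im (`|x| ^+ 2 * y) = `|x| ^+ 2 * 'Im y.
  by rewrite ImMl // rpredX ?normr_real.
move=> + zNreal; elim: rs r => [|s rs IHrs] r /andP[rR rsR] /=.
  rewrite big_seq1 derivXsubC hornerXsubC hornerE mul1r Im_conj mulrN oppr_lt0.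
  rewrite raddfB /= (Creal_ImP r rR) subr0 -expr2 -real_normK ?exprn_gt0 //.
  by rewrite normr_gt0; apply: contraNneq zNreal => /Creal_ImP.
rewrite big_cons derivM derivXsubC mul1r hornerD !hornerM hornerXsubC.
set S := \prod_(r <- _) _.
(* The first summand contributes - |S(z)|^2 ('Im z)^2, which is nonpositive; the second is negative
   by induction. *)
have -> : (S.[z] + (z - r) * S^`().[z]) * ((z - r) * S.[z])^*
   = (S.[z] * S.[z]^*) * (z^* - r)
     + ((z - r) * (z - r)^*) * (S^`().[z] * S.[z]^*).
  by rewrite !(rmorphM, rmorphB) /= (conj_Creal rR); ring.
rewrite -!normCK raddfD /= !ImNl.
rewrite raddfB /= (Creal_ImP r rR) subr0 Im_conj mulrDr.
rewrite -[X in _ < X]addr0 ler_ltD //.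
  rewrite mulrCA mulrN mulr_ge0_le0 ?exprn_ge0 // oppr_le0 -expr2.
  by rewrite real_exprn_even_ge0.
have Slt0 := IHrs s rsR; rewrite mulrCA pmulr_rlt0 // exprn_gt0 //.
rewrite normr_gt0 subr_eq0.
by apply: contraNneq zNreal => ->.
Qed.

(* Gauss-Lucas *)
Lemma real_rooted_deriv P : P \is monic -> (1 < size P)%N ->
  real_rooted P -> real_rooted P^`().
Proof.
move=> Pmon sP Preal; have [[|r rs] rsR Prs] := real_rooted_splits Pmon Preal.
  by move: sP; rewrite Prs big_nil size_poly1.
move=> z /rootP P'z; apply/negP=> /negP zNreal.
by have := Im_logderiv_lt0 rsR zNreal; rewrite /= -Prs P'z mul0r raddf0 mulr0 ltxx.
Qed.

Lemma real_horner_prod rs x : all (mem Num.real) rs -> x \is Num.real ->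
  (\prod_(r <- rs) ('X - r%:P)).[x] \is Num.real.
Proof.
move=> /allP rsR xR; rewrite horner_prod big_seq; apply: rpred_prod => r /rsR rR.
by rewrite hornerXsubC rpredB.
Qed.

(* Laguerre's inequality *)
Lemma laguerre r rs x : all (mem Num.real) (r :: rs) -> x \is Num.real ->
  let P := \prod_(r <- r :: rs) ('X - r%:P) in
  P.[x] != 0 -> P.[x] * P^`()^`().[x] < P^`().[x] ^+ 2.
Proof.
move=> + xR; elim: rs r => [|s rs IHrs] r /andP[rR rsR] /=.
  by rewrite big_seq1 derivXsubC !derivE !hornerE expr1n ltr01.
rewrite big_cons; set S := \prod_(r <- _) _ => Px.
have Sx : S.[x] != 0 by apply: contraNneq Px => Sx0; rewrite hornerM Sx0 mulr0.
have SR : S.[x] \is Num.real by rewrite real_horner_prod.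
have S'R : S^`().[x] ^+ 2 - S.[x] * S^`()^`().[x] > 0 by rewrite subr_gt0 (IHrs s).
rewrite -subr_gt0 !derivM !derivXsubC !mul1r !derivD !derivM !derivXsubC mul1r.
(* For P = (X - r) S, the mixed terms of P'^2 - P P'' cancel. *)
rewrite !(hornerXsubC, hornerD, hornerM) [X in 0 < X](_ : _ =
  S.[x] ^+ 2 + (x - r) ^+ 2 * (S^`().[x] ^+ 2 - S.[x] * S^`()^`().[x])).
  rewrite ltr_pwDl //; first by rewrite real_exprn_even_gt0.
  by rewrite (mulr_ge0 _ (ltW S'R)) // real_exprn_even_ge0 ?rpredB.
by ring.
Qed.

(** * Critical values of a real-rooted polynomial *)

Section CriticalValue.
Variables (P : {poly C}) (x : C).
Hypotheses (P_monic : P \is monic) (sP : (1 < size P)%N).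
Hypotheses (P_rr : real_rooted P) (xR : x \is Num.real) (P'x : P^`().[x] = 0).

Lemma critical_value_sign : P.[x] \is Num.real /\
  (P.[x] != 0 -> P.[x] * P^`()^`().[x] < 0).
Proof.
have [[|r rs] rsR Prs] := real_rooted_splits P_monic P_rr.
  by move: sP; rewrite Prs big_nil size_poly1.
split=> [|Px]; first by rewrite Prs real_horner_prod.
by have := laguerre rsR xR; rewrite /= -Prs P'x expr0n; apply.
Qed.

(** At a critical point Laguerre's inequality says that a nonzero value and P'' have strictly
    opposite signs. Hence a weak sign of P'' suffices, which covers coinciding critical points. *)
Lemma local_max_ge0 : P^`()^`().[x] <= 0 -> 0 <= P.[x].
Proof.
have [PR PP''] := critical_value_sign => P''le.
rewrite real_leNgt ?real0 //; apply/negP=> Plt.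
by have := PP'' (ltr0_neq0 Plt); rewrite le_gtF // mulr_le0 // ltW.
Qed.

Lemma local_min_le0 : 0 <= P^`()^`().[x] -> P.[x] <= 0.
Proof.
have [PR PP''] := critical_value_sign => P''ge.
rewrite real_leNgt ?real0 //; apply/negP=> Pgt.
by have := PP'' (lt0r_neq0 Pgt); rewrite le_gtF // mulr_ge0 // ltW.
Qed.

End CriticalValue.

(* The conjugate pair of roots contributes a factor that is positive on the
   real line, so that [R] has there the signs of [P]. *)
Lemma split_nonreal_root P z : map_poly Num.conj P = P -> P \is monic ->
  root P z -> z \isn't Num.real ->
  exists R : {poly C}, [/\ P = R * (('X - z%:P) * ('X - (z^*)%:P)),
    R \is monic & {in Num.real, forall x, exists2 m, 0 < m & P.[x] = R.[x] * m}].
Proof.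
move=> PR Pmon Pz zNreal.
have zz' : z^* != z by rewrite -CrealE.
have Pz' : root P z^*.
  by rewrite -PR; apply/rootP; rewrite horner_map /= (rootP Pz) rmorph0.
have /factor_theorem[R1 PR1] := Pz.
have /factor_theorem[R RR1] : root R1 z^*.
  by move: Pz'; rewrite PR1 rootM root_XsubC (negPf zz') orbF.
have PE : P = R * (('X - z%:P) * ('X - (z^*)%:P)).
  by rewrite PR1 RR1 -mulrA [('X - (z^*)%:P) * _]mulrC.
exists R; split=> //.
  by move: Pmon; rewrite PE monicMr // monicMl ?monicXsubC.
move=> x xR; exists ((x - z) * (x - z)^*).
  by rewrite mul_conjC_gt0 subr_eq0; apply: contraNneq zNreal => <-.
by rewrite PE !(hornerM, hornerXsubC) rmorphB /= (conj_Creal xR).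
Qed.

(** * Quartics and quintics with alternating critical values *)

Lemma monic_size3 P : P \is monic -> size P = 3 ->
  exists b c, P = 'X^2 + b%:P * 'X + c%:P.
Proof.
move=> /monicP; rewrite /lead_coef => P2 sP; rewrite sP in P2.
exists P`_1, P`_0; apply/polyP=> -[|[|[|i]]];
  rewrite !(coefD, coefMX, coefXn, coefC) /= ?addr0 ?add0r //.
by rewrite nth_default ?sP.
Qed.

Lemma monic_size4 P : P \is monic -> size P = 4 ->
  exists b c d, P = 'X^3 + b%:P * 'X^2 + c%:P * 'X + d%:P.
Proof.
move=> /monicP; rewrite /lead_coef => P2 sP; rewrite sP in P2.
exists P`_2, P`_1, P`_0; apply/polyP=> -[|[|[|[|i]]]];
  rewrite !(coefD, coefCM, coefMX, coefXn, coefX, coefC) /= ?mulr1 ?mulr0 ?addr0 ?add0r //.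
by rewrite nth_default ?sP.
Qed.

(** Since Q does not vanish at x, P and R have the same multiplicity j > 0 there, and in
    characteristic zero P' has multiplicity exactly j - 1. Thus m <= j - 1. *)
Lemma critical_root_multiplicity (P R Q K : {poly C}) (x : C) m :
  P = R * Q -> R != 0 -> Q.[x] != 0 -> P.[x] = 0 ->
  P^`() = ('X - x%:P) ^+ m * K ->
  exists2 S, S != 0 & R = S * ('X - x%:P) ^+ m.+1.
Proof.
move=> PRQ R0 Qx Px P'm.
have [j [S Sx RS]] := multiplicity_XsubC R x; rewrite R0 /= in Sx.
case: (ltnP m j) => [lt_mj | le_jm].
  exists (S * ('X - x%:P) ^+ (j - m.+1)).
    by apply: contraNneq R0 => S0; rewrite RS -(subnK lt_mj) exprD mulrA S0 mul0r.
  by rewrite -mulrA -exprD subnK.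
have SQx : (S * Q).[x] != 0 by rewrite hornerM mulf_neq0.
have PSQ : P = ('X - x%:P) ^+ j * (S * Q) by rewrite PRQ RS; ring.
case: j => [|j] in RS le_jm PSQ.
  by move: SQx; rewrite -Px PSQ mul1r eqxx.
have X0 : ('X - x%:P) ^+ j != 0 by rewrite expf_neq0 // polyXsubC_eq0.
(* Two expressions of P' are divided by their common power and evaluated at x: the right side
   vanishes because j < m, the left side does not. *)
have /(mulfI X0)/(congr1 (fun p => p.[x])) :
    ('X - x%:P) ^+ j * (j.+1%:R * (S * Q) + ('X - x%:P) * (S * Q)^`())
  = ('X - x%:P) ^+ j * (('X - x%:P) ^+ (m - j) * K).
  rewrite [in RHS]mulrA -exprD subnKC ?(ltnW le_jm) // -P'm PSQ [in RHS]derivM deriv_exp.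
  by rewrite derivXsubC /= mul1r -mulr_natl exprS; ring.
rewrite hornerD hornerM [in RHS]hornerM (hornerM ('X - _)).
rewrite horner_exp hornerXsubC subrr.
rewrite expr0n subn_eq0 leqNgt le_jm !mul0r addr0 => /eqP.
by rewrite -[j.+1%:R]polyC_natr hornerC mulf_eq0 pnatr_eq0 (negPf SQx).
Qed.

Lemma cofactor_size P R (z : C) n : R \is monic -> size P = n.+2 ->
  P = R * (('X - z%:P) * ('X - (z^*)%:P)) -> size R = n.
Proof.
move=> Rmon + PRz; rewrite PRz size_monicM ?mulf_neq0 ?polyXsubC_eq0 //.
by rewrite size_monicM ?monicXsubC ?polyXsubC_eq0 // !size_XsubC addn3 => -[].
Qed.

Lemma quartic_real_rooted P a b c :
    map_poly Num.conj P = P -> P \is monic -> size P = 5 ->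
    P^`() = 4%:R * (('X - a%:P) * ('X - b%:P) * ('X - c%:P)) ->
    a \is Num.real -> b \is Num.real -> c \is Num.real -> a <= b -> b <= c ->
    P.[a] <= 0 -> 0 <= P.[b] -> P.[c] <= 0 -> real_rooted P.
Proof.
move=> PR Pmon sP P' aR bR cR leab lebc Pa Pb Pc z Pz; apply/negP=> /negP zNreal.
have [R [PRz Rmon Rsgn]] := split_nonreal_root PR Pmon Pz zNreal.
have sR : size R = 3 by apply: cofactor_size sP PRz.
(* A double root of P' at which P vanishes would be a triple root of R, whose degree is 2. *)
have tie x K : x \is Num.real -> P.[x] = 0 -> P^`() <> ('X - x%:P) ^+ 2 * K.
  move=> xR Px P'x.
  have Qx : (('X - z%:P) * ('X - (z^*)%:P)).[x] != 0.
    rewrite hornerM !hornerXsubC -(conj_Creal xR) -rmorphB /= (conj_Creal xR).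
    by rewrite mul_conjC_eq0 subr_eq0; apply: contraNneq zNreal => <-.
  have [S S0 RS] :=
    critical_root_multiplicity PRz (monic_neq0 Rmon) Qx Px P'x.
  move: sR; rewrite RS size_Mmonic ?monic_exp ?monicXsubC // size_exp_XsubC.
  by move: S0; rewrite -size_poly_gt0; case: (size S) => // k _; rewrite addnC.
have [u [v RE]] := monic_size3 Rmon sR.
have [ma ma0 PRa] := Rsgn a aR; have [mb mb0 PRb] := Rsgn b bR.
have [mc mc0 PRc] := Rsgn c cR.
have Ra : R.[a] <= 0 by rewrite PRa pmulr_lle0 in Pa.
have Rb : 0 <= R.[b] by rewrite PRb pmulr_lge0 in Pb.
have Rc : R.[c] <= 0 by rewrite PRc pmulr_lle0 in Pc.
(* The second divided difference of the monic quadratic R is 1; here the denominators are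
   cleared. *)
have V : (b - a) * (c - a) * (c - b) =
    (c - b) * R.[a] - (c - a) * R.[b] + (b - a) * R.[c].
  by rewrite RE !(hornerE, horner_exp); ring.
have ab : 0 <= b - a by rewrite subr_ge0.
have bc : 0 <= c - b by rewrite subr_ge0.
have ac : 0 <= c - a by rewrite subr_ge0 (le_trans leab).
have : (b - a) * (c - a) * (c - b) == 0.
  rewrite eq_le !mulr_ge0 // andbT V !addr_le0 ?oppr_le0 ?mulr_ge0_le0 //.
  by rewrite mulr_ge0.
rewrite !mulf_eq0 !subr_eq0.
(* At two equal neighbouring critical points P is both nonnegative and nonpositive, so it vanishes
   there and [tie] applies. *)
have e_ab : b <> a.
  move=> e; rewrite e in P' Pb.
  have Pa0 : P.[a] = 0 by apply: le_anti; rewrite Pa Pb.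
  by apply: (tie a (4%:R * ('X - c%:P)) aR Pa0); rewrite P'; ring.
have e_bc : c <> b.
  move=> e; rewrite e in P' Pc.
  have Pb0 : P.[b] = 0 by apply: le_anti; rewrite Pb Pc.
  by apply: (tie b (4%:R * ('X - a%:P)) bR Pb0); rewrite P'; ring.
case/orP=> [/orP[]|] /eqP // e; case: e_ab; apply: le_anti.
by rewrite leab -e lebc.
Qed.

Lemma quintic_real_rooted P a b c d :
    map_poly Num.conj P = P -> P \is monic -> size P = 6 ->
    P^`() = 5%:R * (('X - a%:P) * ('X - b%:P) * ('X - c%:P) * ('X - d%:P)) ->
    a \is Num.real -> b \is Num.real -> c \is Num.real -> d \is Num.real ->
    a <= b -> b <= c -> c <= d ->
    0 <= P.[a] -> P.[b] <= 0 -> 0 <= P.[c] -> P.[d] <= 0 -> real_rooted P.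
Proof.
move=> PR Pmon sP P' aR bR cR dR leab lebc lecd Pa Pb Pc Pd z Pz.
apply/negP=> /negP zNreal.
have [R [PRz Rmon Rsgn]] := split_nonreal_root PR Pmon Pz zNreal.
have sR : size R = 4 by apply: cofactor_size sP PRz.
have [ma ma0 PRa] := Rsgn a aR; have [mb mb0 PRb] := Rsgn b bR.
have [mc mc0 PRc] := Rsgn c cR; have [md md0 PRd] := Rsgn d dR.
have Ra : 0 <= R.[a] by rewrite PRa pmulr_lge0 in Pa.
have Rb : R.[b] <= 0 by rewrite PRb pmulr_lle0 in Pb.
have Rc : 0 <= R.[c] by rewrite PRc pmulr_lge0 in Pc.
have Rd : R.[d] <= 0 by rewrite PRd pmulr_lle0 in Pd.
have triple x m K : x \is Num.real -> P.[x] = 0 -> P^`() = ('X - x%:P) ^+ m * K ->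
    exists2 S, S != 0 & R = S * ('X - x%:P) ^+ m.+1.
  move=> xR Px P'x.
  apply: critical_root_multiplicity PRz (monic_neq0 Rmon) _ Px P'x.
  rewrite hornerM !hornerXsubC -(conj_Creal xR) -rmorphB /= (conj_Creal xR).
  by rewrite mul_conjC_eq0 subr_eq0; apply: contraNneq zNreal => <-.
(* Now R has degree 3, so a triple root is possible, but only if R = (X - x)^3. The signs of R at a
   and d then force x <= a and d <= x, all critical points coincide, and R would have a root of
   multiplicity 4. *)
have tie x K : x \is Num.real -> a <= x -> x <= d -> P.[x] = 0 ->
    P^`() <> ('X - x%:P) ^+ 2 * K.
  move=> xR leax lexd Px P'x; have [S S0 RS] := triple x _ _ xR Px P'x.
  have RX : R = ('X - x%:P) ^+ 3.
    have S1 : S \is monic.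
      by move: Rmon; rewrite RS monicMr // monic_exp ?monicXsubC.
    have sS : size S = 1%N.
      move: sR; rewrite RS size_Mmonic ?monic_exp ?monicXsubC // size_exp_XsubC.
      by rewrite addn4 => -[].
    rewrite RS; suff -> : S = 1 by rewrite mul1r.
    move/eqP/size_poly1P: sS S1 => [s _ ->]; rewrite monicE lead_coefC => /eqP->.
    by [].
  have xd : x = d.
    apply: le_anti; rewrite lexd; move: Rd.
    rewrite RX horner_exp hornerXsubC real_exprn_odd_le0 ?rpredB // subr_le0 => ->.
    by [].
  have xa : x = a.
    apply: le_anti; rewrite leax andbT; move: Ra.
    by rewrite RX horner_exp hornerXsubC real_exprn_odd_ge0 ?rpredB // subr_ge0.
  have eab : b = a by apply: le_anti; rewrite leab -xa xd (le_trans lebc).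
  have ecd : c = d by apply: le_anti; rewrite lecd -xd xa -eab lebc.
  have [|S' S'0 RS'] := triple x 3 (5%:R * ('X - x%:P)) xR Px.
    by rewrite P' eab ecd -xd -xa; ring.
  move: sR; rewrite RS' size_Mmonic ?monic_exp ?monicXsubC // size_exp_XsubC.
  by move: S'0; rewrite -size_poly_gt0; case: (size S') => // k _; rewrite addnC.
have [u [v [w RE]]] := monic_size4 Rmon sR.
have leac := le_trans leab lebc; have lebd := le_trans lebc lecd.
have lead := le_trans leac lecd.
have [ab [ac [ad [bc [bd cd]]]]] : 0 <= b - a /\ 0 <= c - a /\ 0 <= d - a /\
    0 <= c - b /\ 0 <= d - b /\ 0 <= d - c by rewrite !subr_ge0.
(* The third divided difference of the monic cubic R is 1, multiplied by the Vandermonde product. *)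
have V : (b - a) * (c - a) * (d - a) * (c - b) * (d - b) * (d - c) =
    - ((c - b) * (d - b) * (d - c) * R.[a])
    + (c - a) * (d - a) * (d - c) * R.[b]
    - (b - a) * (d - a) * (d - b) * R.[c]
    + (b - a) * (c - a) * (c - b) * R.[d].
  by rewrite RE !(hornerD, hornerM, hornerC, hornerXn, hornerX); ring.
have : (b - a) * (c - a) * (d - a) * (c - b) * (d - b) * (d - c) == 0.
  rewrite eq_le !mulr_ge0 // andbT V !addr_le0 ?oppr_le0 //.
  - by rewrite !mulr_ge0.
  - by rewrite mulr_ge0_le0 // !mulr_ge0.
  - by rewrite !mulr_ge0.
  - by rewrite mulr_ge0_le0 // !mulr_ge0.
have e_ab : b <> a.
  move=> e; rewrite e in P' Pb.
  have P0 : P.[a] = 0 by apply: le_anti; rewrite Pa Pb.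
  by apply: (tie a (5%:R * (('X - c%:P) * ('X - d%:P))) aR _ _ P0); rewrite ?P' //; ring.
have e_bc : c <> b.
  move=> e; rewrite e in P' Pc.
  have P0 : P.[b] = 0 by apply: le_anti; rewrite Pb Pc.
  by apply: (tie b (5%:R * (('X - a%:P) * ('X - d%:P))) bR _ _ P0); rewrite ?P' //; ring.
have e_cd : d <> c.
  move=> e; rewrite e in P' Pd.
  have P0 : P.[c] = 0 by apply: le_anti; rewrite Pc Pd.
  by apply: (tie c (5%:R * (('X - a%:P) * ('X - b%:P))) cR _ _ P0); rewrite ?P' //; ring.
have e_ac : c <> a by move=> e; apply: e_ab; apply: le_anti; rewrite leab -e lebc.
have e_bd : d <> b by move=> e; apply: e_bc; apply: le_anti; rewrite lebc -e lecd.
have e_ad : d <> a by move=> e; apply: e_ab; apply: le_anti; rewrite leab -e lebd.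
by rewrite !mulf_eq0 !subr_eq0 => /orP[/orP[/orP[/orP[/orP[]|]|]|]|] /eqP.
Qed.
End RealRooted.

(** * The polynomials F, G and T *)

Lemma realX_homo (R : numDomainType) (x : R) n :
  x \is Num.real -> x ^+ n \is Num.real.
Proof. exact: rpredX. Qed.

Ltac real_tac := repeat lazymatch goal with
  | |- is_true (in_mem ?e _) => lazymatch e with
    | _ + _ => apply: realD
    | - _ => rewrite realN
    | _ ^+ _ => apply: realX_homo
    | _ * _ => apply: realM
    | _^-1 => rewrite realV
    | _%:R => apply: realn
    | 1 => apply: real1
    | 0 => apply: real0
    end
  end; try assumption.

Lemma Poly_inj (R : nzSemiRingType) (s t : seq R) :
  Poly s = Poly t -> size s = size t -> s = t.
Proof.
move=> Pst st; apply: (@eq_from_nth _ 0) => // i _.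
by rewrite -(coef_Poly s) Pst coef_Poly.
Qed.

Lemma monic_Poly (R : nzRingType) (s : seq R) :
  last 0 s = 1 -> Poly s \is monic /\ size (Poly s) = size s.
Proof.
move=> s1; have Ps : Poly s = s :> seq R.
  by apply: (@PolyK _ 0); rewrite s1 oner_eq0.
by rewrite Ps monicE /lead_coef Ps nth_last s1.
Qed.

Lemma conj_Poly (C : numClosedFieldType) (s : seq C) :
  all (mem Num.real) s -> map_poly Num.conj (Poly s) = Poly s.
Proof.
move=> sR; apply/polyP=> i; rewrite coef_map /= coef_Poly conj_Creal //.
have [lt_is|le_si] := ltnP i (size s); first exact: (allP sR _ (mem_nth 0 lt_is)).
by rewrite nth_default ?rpred0.
Qed.

Lemma PolyE (R : nzSemiRingType) :
  (Poly [::] = 0 :> {poly R}) *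
  (forall (a : R) s, Poly (a :: s) = Poly s * 'X + a%:P).
Proof. by split=> // a s; rewrite -cons_poly_def. Qed.

Lemma horner_PolyE (R : nzSemiRingType) (x : R) :
  ((Poly [::]).[x] = 0) *
  (forall a s, (Poly (a :: s)).[x] = (Poly s).[x] * x + a).
Proof. by split=> [|a s]; rewrite PolyE ?horner0 ?hornerMXaddC. Qed.

Section Polynomials.
Variable c : coefs.

Definition real_coefs : Prop :=
  [/\ cq c \is Num.real, c1 c \is Num.real, c2 c \is Num.real,
      c3 c \is Num.real & c4 c \is Num.real /\ c5 c \is Num.real].

(* [hpoly] is x^5 fpoly(x + q/x), [Fpoly] is [fpoly] shifted to have no
   quartic term, and [Gpoly], [Tpoly] are its successive normalized
   derivatives. *)
Definition fpoly : {poly algC} :=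
  Poly [:: c5 c - 2 * cq c * c3 c + 2 * cq c ^+ 2 * c1 c;
           c4 c - 3 * cq c * c2 c + 5 * cq c ^+ 2;
           c3 c - 4 * cq c * c1 c; c2 c - 5 * cq c; c1 c; 1].
Definition Fpoly : {poly algC} :=
  Poly [:: c5 c - Aval c; 5 * u4 c; 10 * u3 c; 10 / 3 * u2 c; 0; 1].
Definition Gpoly : {poly algC} := Poly [:: u4 c; 4 * u3 c; 2 * u2 c; 0; 1].
Definition Tpoly : {poly algC} := Poly [:: u3 c; u2 c; 0; 1].

Lemma monic_Tpoly : Tpoly \is monic /\ size Tpoly = 4.
Proof. exact: (@monic_Poly _ [:: _; _; _; _]). Qed.

Lemma monic_Gpoly : Gpoly \is monic /\ size Gpoly = 5.
Proof. exact: (@monic_Poly _ [:: _; _; _; _; _]). Qed.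

Lemma monic_Fpoly : Fpoly \is monic /\ size Fpoly = 6.
Proof. exact: (@monic_Poly _ [:: _; _; _; _; _; _]). Qed.

Lemma monic_fpoly : fpoly \is monic /\ size fpoly = 6.
Proof. exact: (@monic_Poly _ [:: _; _; _; _; _; _]). Qed.

Lemma deriv_Fpoly : Fpoly^`() = 5%:R * Gpoly.
Proof.
rewrite /Fpoly /Gpoly; set v := 2 / 3 * u2 c.
have -> : 10 / 3 * u2 c = 5 * v by rewrite /v; field.
have -> : 2 * u2 c = 3 * v by rewrite /v; field.
by rewrite !PolyE !derivE; ring.
Qed.

Lemma deriv_Gpoly : Gpoly^`() = 4%:R * Tpoly.
Proof. by rewrite /Tpoly /Gpoly !PolyE !derivE; ring. Qed.

Lemma fpoly_shift y : fpoly.[y] = Fpoly.[y + c1 c / 5].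
Proof.
(* Writing a_1 = 5 b clears all denominators, and the claim becomes an identity with integer
   coefficients. *)
have e1 : c1 c = 5 * (c1 c / 5) by field.
rewrite /fpoly /Fpoly /Aval /u2 /u3 /u4; move: (c1 c / 5) e1 => b ->.
rewrite !horner_PolyE.
have -> : 10 / 3 * (- (3 * (5 * b) ^+ 2) / 25 + 3 * c2 c / 10 - 3 * cq c / 2)
  = - 10 * b ^+ 2 + c2 c - 5 * cq c by field.
have -> : 10 * (2 * (5 * b) ^+ 3 / 125 - 3 * (5 * b) * c2 c / 50
    - cq c * (5 * b) / 10 + c3 c / 10)
  = 20 * b ^+ 3 - 3 * b * c2 c - 5 * cq c * b + c3 c by field.
have -> : 5 * (- (3 * (5 * b) ^+ 4) / 625 + 3 * (5 * b) ^+ 2 * c2 c / 125 +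
    cq c * (5 * b) ^+ 2 / 5 - 2 * (5 * b) * c3 c / 25 - 3 * cq c * c2 c / 5 +
    c4 c / 5 + cq c ^+ 2)
  = - 15 * b ^+ 4 + 3 * b ^+ 2 * c2 c + 25 * cq c * b ^+ 2 - 2 * b * c3 c
    - 3 * cq c * c2 c + c4 c + 5 * cq c ^+ 2 by field.
have -> : - (4 * (5 * b) ^+ 5) / 3125 + (5 * b) ^+ 3 * (c2 c + 15 * cq c) / 125 -
      (5 * b) ^+ 2 * c3 c / 25 -
      5 * b * (3 * c2 c * cq c - c4 c + 5 * cq c ^+ 2) / 5 + 2 * cq c * c3 c
  = - 4 * b ^+ 5 + b ^+ 3 * (c2 c + 15 * cq c) - b ^+ 2 * c3 c
    - b * (3 * c2 c * cq c - c4 c + 5 * cq c ^+ 2) + 2 * cq c * c3 c by field.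
ring.
Qed.

(** The sign of F at a critical point thus compares a_5 with H + A, as (h) does. *)
Lemma Fpoly_Hf x : Fpoly.[x] = c5 c - Aval c - Hf c x.
Proof. by rewrite /Fpoly /Hf !horner_PolyE; field. Qed.

Hypothesis cR : real_coefs.

Lemma real_u : [/\ u2 c \is Num.real, u3 c \is Num.real & u4 c \is Num.real].
Proof.
case: cR => qR r1 r2 r3 [r4 r5].
split; rewrite /u2 /u3 /u4; real_tac.
Qed.

End Polynomials.
Arguments real_u {c}.

(** * The cubic T and the set S *)

Lemma prod_seq3 (R : comNzRingType) (x y z : R) :
  \prod_(r <- [:: x; y; z]) ('X - r%:P) =
  Poly [:: - (x * y * z); x * y + x * z + y * z; - (x + y + z); 1].
Proof. by rewrite !big_cons big_nil !PolyE; ring. Qed.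

Section CubicRoots.
Variable c : coefs.
Hypothesis cR : real_coefs c.

(** This is u_4 - G(b) after b^4 has been reduced by T(b) = 0. *)
Definition theta_of (b : algC) : algC := - u2 c * b ^+ 2 - 3 * u3 c * b.

(** Condition (e) quantifies over all admissible choices of roots, so information can be drawn from
    it only once a choice exists. *)
Lemma S_ok_exists : exists s, S_ok c s.
Proof.
have [zeta zeta3] := C_prim_root_exists (isT : (0 < 3)%N).
pose sD := sqrtC (Delta c); pose om := 3.-root ((- u3 c + sD) / 2).
exists (S_vals c zeta sD om); exists zeta, sD, om; split=> //; split.
  by split; rewrite ?sqrtCK ?sqrtC_gt0.
by split=> //; rewrite /om rootCK.
Qed.

Lemma prim3_rootP (z : algC) : 3.-primitive_root z ->
  [/\ z ^+ 2 = - 1 - z, z^-1 = - 1 - z & z^* = - 1 - z].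
Proof.
move=> z3; have z31 : z ^+ 3 = 1 := prim_expr_order z3.
have z1 : z != 1.
  by have := prim_order_dvd z3 1; rewrite expr1 => <-.
have z2 : z ^+ 2 = - 1 - z.
  have /eqP : (z - 1) * (z ^+ 2 + z + 1) = 0.
    by rewrite [LHS](_ : _ = z ^+ 3 - 1); [rewrite z31 subrr | ring].
  rewrite mulf_eq0 subr_eq0 (negPf z1) /= => /eqP e.
  by rewrite -[LHS](addr0) -[0]oppr0 -e; ring.
have z0 : z != 0 by apply: contra_eq_neq z31 => ->; rewrite expr0n eq_sym oner_neq0.
have zV : z^-1 = - 1 - z by rewrite -z2; apply: (mulfI z0); rewrite divff // -exprS z31.
split=> //; rewrite -zV; apply: (mulfI z0); rewrite divff // -normCK.
have : `|z| ^+ 3 == 1 ^+ 3 by rewrite -normrX z31 normr1 expr1n.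
by rewrite eqrXn2 ?ler01 // => /eqP ->; rewrite expr1n.
Qed.

Lemma Delta_le0_u2 : Delta c <= 0 -> u2 c <= 0.
Proof.
have [u2R u3R _] := real_u cR; rewrite /Delta => D0.
have : 4 / 27 * u2 c ^+ 3 <= 0.
  by apply: le_trans D0; rewrite lerDr real_exprn_even_ge0.
rewrite pmulr_rle0 ?divr_gt0 ?ltr0n //.
by rewrite real_exprn_odd_le0.
Qed.

(** Cardano's formula in the casus irreducibilis. For Delta <= 0 the root [sD] is purely imaginary,
    so the conjugate of omega is a cube root of the conjugate radicand, and the roots zeta^k omega +
    zeta^-k conj(omega) of T are self-conjugate. *)
Lemma S_ok_roots s : Delta c <= 0 -> S_ok c s ->
  exists bs, [/\ all (mem Num.real) bs,
    Tpoly c = \prod_(b <- bs) ('X - b%:P) & s = map theta_of bs].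
Proof.
move=> D0 [z [sD [om [z3 [[sD2 _] [om3 ->]]]]]].
have [u2R u3R _] := real_u cR; have u2le := Delta_le0_u2 D0.
have [z2 zV zC] := prim3_rootP z3.
have DR : Delta c \is Num.real by rewrite realE D0 orbT.
have sDC : sD^* = - sD.
  have : sD^* ^+ 2 == sD ^+ 2 by rewrite -rmorphXn sD2 /= (conj_Creal DR).
  rewrite eqf_sqr => /orP[|/eqP //]; rewrite -CrealE => sDR.
  have : sD ^+ 2 == 0.
    by rewrite eq_le sD2 D0 -sD2 real_exprn_even_ge0.
  by rewrite sqrf_eq0 => /eqP ->; rewrite conjC0 oppr0.
set w := om^*; have wC : w^* = om by rewrite conjCK.
have w3 : w ^+ 3 = (- u3 c - sD) / 2.
  rewrite /w -rmorphXn om3 /= rmorphM fmorphV rmorph_nat rmorphD rmorphN /= sDC.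
  by rewrite (conj_Creal u3R).
have u2E : u2 c = - 3 * (om * w).
  (* Both sides are nonnegative reals, so it suffices to compare their cubes. *)
  have : om * w == - u2 c / 3.
    rewrite -(@eqrXn2 _ 3) ?mul_conjC_ge0 ?divr_ge0 ?oppr_ge0 ?ler0n //.
    rewrite exprMn om3 w3; apply/eqP.
    have -> : (- u3 c + sD) / 2 * ((- u3 c - sD) / 2) = (u3 c ^+ 2 - sD ^+ 2) / 4.
      by field.
    by rewrite sD2 /Delta; field.
  by move/eqP->; field.
have u3E : u3 c = - (om ^+ 3 + w ^+ 3) by rewrite om3 w3; field.
have sDE : sD = om ^+ 3 - w ^+ 3 by rewrite om3 w3; field.
exists [:: om + w; z * om + (- 1 - z) * w; (- 1 - z) * om + z * w]; split.
- have H x : x^* = x -> x \in Num.real by move/eqP; rewrite -CrealE.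
  apply/allP=> x; rewrite !inE => /or3P[] /eqP -> /=; apply: H;
  rewrite !(rmorphD, rmorphM, rmorphN, rmorph1) /= ?wC ?zC -/w //; ring.
- rewrite prod_seq3 /Tpoly; congr Poly; congr [:: _; _; _; _].
  + by rewrite u3E; ring: z2.
  + by rewrite u2E; ring: z2.
  + by ring.
rewrite /S_vals /= !(expr0, expr1) invr1 zV; congr [:: _; _; _].
- by rewrite /theta_of u2E u3E sDE; field.
- by rewrite /theta_of u2E u3E sDE; field: z2.
- by rewrite -exprVn zV /theta_of u2E u3E sDE; field: z2.
Qed.

(** The discriminant of T is - 27 Delta, and it is the square of a real number when the roots are
    real. *)
Lemma real_rooted_Delta : real_rooted (Tpoly c) -> Delta c <= 0.
Proof.
have [Tmon sT] := monic_Tpoly c.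
move=> /(real_rooted_splits Tmon)[rs rsR Trs].
have : size rs = 3 by have := sT; rewrite Trs size_prod_XsubC => -[].
case: rs => [|x [|y [|z []]]] //= in rsR Trs *.
case/and4P: rsR => xR yR zR _ _.
move: Trs; rewrite prod_seq3 => /Poly_inj/(_ erefl)[u3E u2E e1].
have zE : z = - x - y by rewrite -[z]addr0 e1; ring.
rewrite /Delta u3E u2E [X in X <= 0](_ : _ =
  - (((x - y) * (x - z) * (y - z)) ^+ 2 / 27)); last by rewrite zE; field.
rewrite oppr_le0 divr_ge0 ?ler0n // real_exprn_even_ge0 //; real_tac.
Qed.

(** With D = 4 a_1^2 + 50 q - 10 a_2 one has u_2 = - 3 D / 100, and (b) says D >= 0. Since a_3 =
    [c_mid] + 10 u_3, (c) bounds |10 u_3| by D^(3/2) / 50; squaring gives 100 Delta <= 0. *)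
Lemma Delta_le0_bc : Delta c <= 0 <-> cond_b c /\ cond_c c.
Proof.
have [u2R u3R _] := real_u cR; have [qR a1R a2R a3R _] := cR.
pose D := 4 * c1 c ^+ 2 + 50 * cq c - 10 * c2 c.
have DR : D \is Num.real by rewrite /D; real_tac.
have u2E : u2 c = - (3 / 100 * D) by rewrite /u2 /D; field.
have bE : cond_b c <-> 0 <= D.
  rewrite /cond_b -subr_ge0 [X in 0 <= X](_ : _ = D / 10); last by rewrite /D; field.
  by rewrite pmulr_lge0 ?invr_gt0 ?ltr0n.
have cE : 0 <= D -> cond_c c <-> Delta c <= 0.
  move=> D0; rewrite /cond_c /c_rad -/D.
  have r0 : 0 <= sqrtC D ^+ 3 / 50 by rewrite divr_ge0 ?ler0n ?exprn_ge0 ?sqrtC_ge0.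
  have -> : c3 c = c_mid c + 10 * u3 c by rewrite /u3 /c_mid; field.
  rewrite lerD2l lerD2l -real_ler_norml; last by real_tac.
  rewrite -ler_sqr ?nnegrE // real_normK; last by real_tac.
  have -> : (sqrtC D ^+ 3 / 50) ^+ 2 = D ^+ 3 / 2500.
    by rewrite -{2}(sqrtCK D); field.
  rewrite -subr_le0 [X in X <= 0](_ : _ = 100 * Delta c).
    by rewrite pmulr_rle0 ?ltr0n.
  by rewrite /Delta u2E; field.
split=> [D0|[/bE D0]]; last by move/(cE D0).
have D1 : 0 <= D.
  by have := Delta_le0_u2 D0; rewrite u2E oppr_le0 pmulr_rge0 ?divr_gt0 ?ltr0n.
by split; [apply/bE | apply/cE].
Qed.
End CubicRoots.

(** * Sorting real lists, and condition (e) *)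

Lemma real_sort_sorted (s : seq algC) :
  all (mem Num.real) s -> sorted <=%R (sort <=%R s).
Proof. by move=> sR; apply: (sort_sorted_in (@real_leVge _)). Qed.

Lemma sort_perm_real (s t : seq algC) : all (mem Num.real) t ->
  perm_eq s t -> sorted <=%R t -> sort <=%R s = t.
Proof.
move=> tR st t_sorted; have /perm_sort_inP : perm_eq t s by rewrite perm_sym.
move=> <-; first by apply: sort_le_id.
- by move=> x y /(allP tR) xR /(allP tR) yR; apply: real_leVge.
- by move=> x y z _ _ _; apply: le_trans.
- by move=> x y _ _; apply: le_anti.
Qed.

Section Quartic.
Variable c : coefs.
Hypothesis cR : real_coefs c.

Lemma Gpoly_theta b : root (Tpoly c) b -> (Gpoly c).[b] = u4 c - theta_of c b.
Proof.
move=> /rootP; rewrite /Tpoly /Gpoly /theta_of !horner_PolyE => Tb.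
have b3 : b ^+ 3 = - u2 c * b - u3 c.
  by apply/eqP; rewrite -subr_eq0; apply/eqP; rewrite -[RHS]Tb; ring.
by ring: b3.
Qed.

Lemma cond_eP : Delta c <= 0 -> exists b1 b2 b3,
  [/\ all (mem Num.real) [:: b1; b2; b3], b1 <= b2 /\ b2 <= b3,
      Tpoly c = \prod_(b <- [:: b1; b2; b3]) ('X - b%:P) &
      cond_e c <-> [/\ (Gpoly c).[b1] <= 0, 0 <= (Gpoly c).[b2]
                     & (Gpoly c).[b3] <= 0]].
Proof.
move=> D0; have [u2R u3R u4R] := real_u cR; have [s0 s0ok] := S_ok_exists c.
have [bs0 [bs0R Tbs0 _]] := S_ok_roots cR D0 s0ok.
have pbs : perm_eq (sort <=%R bs0) bs0 by rewrite perm_sort.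
have bsS := real_sort_sorted bs0R.
have bsR : all (mem Num.real) (sort <=%R bs0) by rewrite (perm_all _ pbs).
have Tbs : Tpoly c = \prod_(b <- sort <=%R bs0) ('X - b%:P).
  by rewrite (perm_big _ pbs).
have : size (sort <=%R bs0) = 3.
  by have [_] := monic_Tpoly c; rewrite Tbs size_prod_XsubC => -[].
move: bsS bsR Tbs {pbs}; case: (sort _ _) => [|b1 [|b2 [|b3 []]]] //= bsS bsR Tbs _.
exists b1, b2, b3; move: bsS bsR => /and3P[le12 le23 _] /and4P[b1R b2R b3R _].
split; rewrite /= ?b1R ?b2R ?b3R //.
have Gb b : b \in [:: b1; b2; b3] -> (Gpoly c).[b] = u4 c - theta_of c b.
  by move=> bin; rewrite Gpoly_theta // Tbs root_prod_XsubC.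
have thR b : b \is Num.real -> theta_of c b \is Num.real.
  by move=> bR; rewrite /theta_of; real_tac.
move: (Tbs); rewrite prod_seq3 => /Poly_inj/(_ erefl)[u3E u2E e1].
have b3E : b3 = - b1 - b2 by rewrite -[b3]addr0 e1; ring.
have le13 := le_trans le12 le23.
have [h21 h32 h31] : [/\ 0 <= b2 - b1, 0 <= b3 - b2 & 0 <= b3 - b1].
  by rewrite !subr_ge0.
(* The difference is G(b2) - G(b1), the integral of 4 T from b1 to b2. *)
have th21 : theta_of c b2 <= theta_of c b1.
  rewrite -subr_ge0.
  have -> : theta_of c b1 - theta_of c b2 =
    (b2 - b1) ^+ 3 * ((b3 - b1) + (b3 - b2)) / 3.
    by rewrite /theta_of u2E u3E b3E; field.
  by rewrite divr_ge0 ?ler0n // mulr_ge0 ?exprn_ge0 // addr_ge0.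
have th23 : theta_of c b2 <= theta_of c b3.
  rewrite -subr_ge0.
  have -> : theta_of c b3 - theta_of c b2 =
    (b3 - b2) ^+ 3 * ((b3 - b1) + (b2 - b1)) / 3.
    by rewrite /theta_of u2E u3E b3E; field.
  by rewrite divr_ge0 ?ler0n // mulr_ge0 ?exprn_ge0 // addr_ge0.
have sort_s s : S_ok c s -> sort <=%R s =
    if theta_of c b1 <= theta_of c b3
    then [:: theta_of c b2; theta_of c b1; theta_of c b3]
    else [:: theta_of c b2; theta_of c b3; theta_of c b1].
  move=> /(S_ok_roots cR D0)[bs [_ Tbs' ->]].
  have pbs : perm_eq (map (theta_of c) bs) (map (theta_of c) [:: b1; b2; b3]).
    by apply/perm_map/prod_XsubC_eq; rewrite -Tbs' Tbs.
  apply: sort_perm_real.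
  - by case: ifP; rewrite /= !thR.
  - apply: perm_trans pbs _ => /=.
    by case: ifP => _; apply/permP=> a /=; ring.
  - case: (real_leP (thR _ b1R) (thR _ b3R)) => /= [|/ltW] ->; rewrite ?th21 ?th23 //.
have aE th : e_base c + 5 * th <= c4 c <-> th <= u4 c.
  rewrite -subr_ge0.
  have -> : c4 c - (e_base c + 5 * th) = 5 * (u4 c - th)
    by rewrite /e_base /u4; field.
  by rewrite pmulr_rge0 ?ltr0n // subr_ge0.
have aE' th : c4 c <= e_base c + 5 * th <-> u4 c <= th.
  rewrite -subr_ge0.
  have -> : e_base c + 5 * th - c4 c = 5 * (th - u4 c)
    by rewrite /e_base /u4; field.
  by rewrite pmulr_rge0 ?ltr0n // subr_ge0.
rewrite !Gb ?inE ?eqxx ?orbT // !subr_le0 subr_ge0.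
split=> [/(_ s0 s0ok)|[h1 h2 h3] s sok] /=.
  rewrite sort_s //; case: (real_leP (thR _ b1R) (thR _ b3R)) => [le|/ltW le] /=;
  by move=> /andP[/aE h2 /aE' h1]; split=> //; apply: le_trans h1 le.
rewrite sort_s //; case: ifP => _ /=; apply/andP; split; by [apply/aE | apply/aE'].
Qed.
End Quartic.

(** * Ferrari's formula *)

Lemma prod_seq4 (R : comNzRingType) (x y z t : R) :
  \prod_(r <- [:: x; y; z; t]) ('X - r%:P) =
  Poly [:: x * y * z * t; - (x * y * z + x * y * t + x * z * t + y * z * t);
           x * y + x * z + x * t + y * z + y * t + z * t; - (x + y + z + t); 1].
Proof. by rewrite !big_cons big_nil !PolyE; ring. Qed.

Lemma rootc_sqrtC (x : algC) : rootc 2 x (sqrtC x).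
Proof. by split; rewrite ?sqrtCK ?sqrtC_gt0. Qed.

Section Quintic.
Variable c : coefs.

(** As for S, a choice of roots must exist before the universally quantified condition (h) can be
    exploited. *)
Lemma X_ok_exists : exists xs, X_ok c xs.
Proof.
rewrite /X_ok; case: eqP => _.
  pose s0 := sqrtC (u2 c ^+ 2 - u4 c).
  exists [:: sqrtC (- u2 c + s0); sqrtC (- u2 c - s0);
    - sqrtC (- u2 c + s0); - sqrtC (- u2 c - s0)].
  by exists s0, (sqrtC (- u2 c + s0)), (sqrtC (- u2 c - s0)); do !split;
     rewrite ?sqrtCK ?sqrtC_gt0.
pose sD := sqrtC (v3 c ^+ 2 + 4 / 27 * v2 c ^+ 3).
pose C := if v2 c == 0 then 3.-root (- v3 c) else 3.-root ((- v3 c + sD) / 2).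
pose y := C - v2 c / (3 * C) - 2 * u2 c / 3.
pose t := sqrtC (2 * y).
pose r1 := sqrtC (- 4 * u2 c - 2 * y - 8 * u3 c / t).
pose r2 := sqrtC (- 4 * u2 c - 2 * y + 8 * u3 c / t).
exists [:: (t + r1) / 2; (t - r1) / 2; (- t + r2) / 2; (- t - r2) / 2].
exists sD, C, t, r1, r2; split.
  by rewrite /C; case: (v2 c == 0); rewrite ?rootCK //; split=> //; exact: rootc_sqrtC.
by do !split; rewrite ?sqrtCK ?sqrtC_gt0.
Qed.

(** For u_3 = 0, G is biquadratic. Otherwise y solves the resolvent cubic y ((y + u_2)^2 - u_4) = 2
    u_3^2, and with t^2 = 2 y and k = 2 u_3 / t, G = (X^2 - t X + u_2 + y + k) (X^2 + t X + u_2 + y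
    - k). *)
Lemma X_ok_prod xs : X_ok c xs -> Gpoly c = \prod_(x <- xs) ('X - x%:P).
Proof.
rewrite /X_ok; case: eqP => [u30|/eqP u30].
  move=> [s0 [s1 [s2 [[s0E _] [[s1E _] [[s2E _] ->]]]]]].
  rewrite prod_seq4 /Gpoly u30; congr Poly; congr [:: _; _; _; _; _].
  - rewrite [RHS](_ : _ = s1 ^+ 2 * s2 ^+ 2); last by ring.
    by rewrite s1E s2E; ring: s0E.
  - by ring.
  - by ring: s1E s2E.
  - by ring.
move=> [sD [C [t [r1 [r2 [CE]]]]]]; cbv zeta.
set y := C - v2 c / (3 * C) - 2 * u2 c / 3 => -[[tE _] [[r1E _] [[r2E _] ->]]].
have yE : y * ((y + u2 c) ^+ 2 - u4 c) = 2 * u3 c ^+ 2.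
  pose z := C - v2 c / (3 * C).
  (* The shift z = y + 2 u_2 / 3 removes the quadratic term of the resolvent, and Cardano's formula
     gives z. *)
  have zE : z ^+ 3 + v2 c * z + v3 c = 0.
    rewrite /z; move: CE; case: eqP => [-> C3|/eqP v20 [[sDE _] C3]].
      by rewrite !mul0r subr0 C3; ring.
    (* If C = 0 then [sD] = v_3, and the equation for [sD]^2 leaves v_2^3 = 0. *)
    have C0 : C != 0.
      apply: contraNneq v20 => C0; move/eqP: C3; rewrite C0 expr0n /= eq_sym.
      rewrite mulf_eq0 invr_eq0 pnatr_eq0 orbF addrC subr_eq0 => /eqP sDv.
      move/eqP: sDE; rewrite sDv -subr_eq0 opprD addrA subrr sub0r oppr_eq0.
      by rewrite mulf_eq0 (mulf_eq0 4) invr_eq0 !pnatr_eq0 /= expf_eq0.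
    have -> : (C - v2 c / (3 * C)) ^+ 3 + v2 c * (C - v2 c / (3 * C)) + v3 c
      = ((C ^+ 3) ^+ 2 + v3 c * C ^+ 3 - v2 c ^+ 3 / 27) / C ^+ 3 by field.
    suff -> : (C ^+ 3) ^+ 2 + v3 c * C ^+ 3 - v2 c ^+ 3 / 27 = 0 by rewrite mul0r.
    rewrite C3 [LHS](_ : _ = (sD ^+ 2 - v3 c ^+ 2 - 4 / 27 * v2 c ^+ 3) / 4).
      by rewrite sDE; field.
    by field.
  have -> : y = z - 2 * u2 c / 3 by [].
  apply/eqP; rewrite -subr_eq0 -zE; apply/eqP; rewrite /v2 /v3; by field.
(* The resolvent has the nonzero right side 2 u_3^2, so y and t are nonzero and division by t is
   legitimate. *)
clearbody y; have y0 : y != 0.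
  by apply: contra_eq_neq yE => ->; rewrite mul0r eq_sym mulf_neq0 ?expf_neq0 ?pnatr_eq0.
have t0 : t != 0.
  by apply: contra_eq_neq tE => ->; rewrite expr0n eq_sym mulf_neq0 ?pnatr_eq0.
have e1 : (t + r1) / 2 * ((t - r1) / 2) = u2 c + y + 2 * u3 c / t.
  rewrite [LHS](_ : _ = (t ^+ 2 - r1 ^+ 2) / 4); last by field.
  by rewrite tE r1E; field.
have e2 : (- t + r2) / 2 * ((- t - r2) / 2) = u2 c + y - 2 * u3 c / t.
  rewrite [LHS](_ : _ = (t ^+ 2 - r2 ^+ 2) / 4); last by field.
  by rewrite tE r2E; field.
rewrite !big_cons big_nil mulr1 mulrA.
have P1 (p q a b : algC) : p + q = a -> p * q = b ->
    ('X - p%:P) * ('X - q%:P) = 'X^2 - a%:P * 'X + b%:P.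
  by move=> <- <-; ring.
rewrite (P1 _ _ t _ _ e1); last by field.
rewrite (P1 _ _ (- t) _ _ e2); last by field.
set k := 2 * u3 c / t.
have kt : k * t = 2 * u3 c by rewrite /k; field.
have kk : k ^+ 2 = (u2 c + y) ^+ 2 - u4 c.
  apply: (mulfI y0); rewrite [y + _]addrC in yE; rewrite yE.
  have -> : y = t ^+ 2 / 2 by rewrite tE; field.
  by rewrite /k; field.
rewrite /Gpoly !PolyE.
rewrite [u4 c](_ : _ = (u2 c + y) ^+ 2 - k ^+ 2); last by rewrite kk; ring.
rewrite [4 * u3 c](_ : _ = 2 * (k * t)); last by rewrite kt; ring.
rewrite [2 * u2 c](_ : _ = 2 * (u2 c + y) - t ^+ 2); last by rewrite tE; ring.
by ring.
Qed.
End Quintic.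

(** * Real-rootedness of G and F *)

Lemma real_rooted_natl (C : numClosedFieldType) (P : {poly C}) n :
  real_rooted (n.+1%:R * P) -> real_rooted P.
Proof.
by move=> nP z Pz; apply: nP; rewrite mulr_natl rootE hornerMn (rootP Pz) mul0rn.
Qed.

Section RealRootedQuintic.
Variable c : coefs.
Hypothesis cR : real_coefs c.

Lemma conj_Fpoly : map_poly Num.conj (Fpoly c) = Fpoly c.
Proof.
have [qR a1R a2R a3R [a4R a5R]] := cR; have [u2R u3R u4R] := real_u cR.
apply: conj_Poly; apply/allP => x; rewrite !inE => xin.
have AR : Aval c \is Num.real by rewrite /Aval; real_tac.
by case/or4P: xin => [|||/or3P[]] /eqP->; real_tac.
Qed.

Lemma conj_Gpoly : map_poly Num.conj (Gpoly c) = Gpoly c.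
Proof.
have [u2R u3R u4R] := real_u cR.
apply: conj_Poly; apply/allP => x; rewrite !inE => xin.
by case/or4P: xin => [|||/orP[]] /eqP->; real_tac.
Qed.

Lemma real_rooted_FG : real_rooted (Fpoly c) -> real_rooted (Gpoly c).
Proof.
have [Fmon sF] := monic_Fpoly c.
move=> /(real_rooted_deriv Fmon); rewrite sF deriv_Fpoly => /(_ isT).
exact: real_rooted_natl.
Qed.

Lemma real_rooted_GT : real_rooted (Gpoly c) -> real_rooted (Tpoly c).
Proof.
have [Gmon sG] := monic_Gpoly c.
move=> /(real_rooted_deriv Gmon); rewrite sG deriv_Gpoly => /(_ isT).
exact: real_rooted_natl.
Qed.

Lemma Gpoly_condsP : real_rooted (Gpoly c) <-> Delta c <= 0 /\ cond_e c.
Proof.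
have [Gmon sG] := monic_Gpoly c.
have horner4 (P : {poly algC}) x : (4%:R * P).[x] = 4 * P.[x].
  by rewrite mulr_natl hornerMn mulr_natl.
split=> [Grr|[D0 ce]].
  have D0 := real_rooted_Delta (real_rooted_GT Grr); split=> //.
  have [b1 [b2 [b3 [/and4P[/= b1R b2R b3R _] [le12 le23] Tb ceE]]]] := cond_eP cR D0.
  have [h21 h32] : 0 <= b2 - b1 /\ 0 <= b3 - b2 by rewrite !subr_ge0.
  have h31 : 0 <= b3 - b1 by rewrite subr_ge0 (le_trans le12).
  have G'' : (Gpoly c)^`()^`() = 4%:R * (Tpoly c)^`().
    by rewrite deriv_Gpoly !mulr_natl derivMn.
  have crit b : b \in [:: b1; b2; b3] -> (Gpoly c)^`().[b] = 0.
    rewrite -root_prod_XsubC -Tb => /rootP Tb0.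
    by rewrite deriv_Gpoly horner4 Tb0 mulr0.
  (* At a root of T two of the three products vanish, and the order of the roots gives the sign of
     the third. *)
  have T'E b : (Tpoly c)^`().[b] =
      (b - b1) * (b - b2) + (b - b1) * (b - b3) + (b - b2) * (b - b3).
    rewrite Tb !big_cons big_nil mulr1 !derivM !derivXsubC.
    by rewrite !(hornerXsubC, hornerD, hornerM, hornerC); ring.
  apply/ceE; split.
  - apply: local_min_le0 Gmon _ Grr b1R _ _; rewrite ?sG ?crit ?inE ?eqxx //.
    rewrite G'' horner4 T'E mulr_ge0 ?ler0n //.
    by rewrite [X in 0 <= X](_ : _ = (b2 - b1) * (b3 - b1)) ?mulr_ge0 //;
      ring.
  - apply: local_max_ge0 Gmon _ Grr b2R _ _; rewrite ?sG ?crit ?inE ?eqxx ?orbT //.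
    rewrite G'' horner4 T'E mulr_ge0_le0 ?ler0n //.
    rewrite [X in X <= 0](_ : _ = - ((b2 - b1) * (b3 - b2))); last by ring.
    by rewrite oppr_le0 mulr_ge0.
  - apply: local_min_le0 Gmon _ Grr b3R _ _; rewrite ?sG ?crit ?inE ?eqxx ?orbT //.
    rewrite G'' horner4 T'E mulr_ge0 ?ler0n //.
    by rewrite [X in 0 <= X](_ : _ = (b3 - b1) * (b3 - b2)) ?mulr_ge0 //;
      ring.
have [b1 [b2 [b3 [/and4P[/= b1R b2R b3R _] [le12 le23] Tb ceE]]]] := cond_eP cR D0.
have /ceE[G1 G2 G3] := ce.
apply: (quartic_real_rooted conj_Gpoly Gmon sG _ b1R b2R b3R) => //.
by rewrite deriv_Gpoly Tb !big_cons big_nil mulr1 mulrA.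
Qed.

Lemma X_ok_real xs : real_rooted (Gpoly c) -> X_ok c xs -> all (mem Num.real) xs.
Proof.
move=> Grr /X_ok_prod Gxs; apply/allP=> x xin; apply: Grr.
by rewrite Gxs root_prod_XsubC.
Qed.

Lemma Fpoly_condsP :
  real_rooted (Fpoly c) <-> [/\ Delta c <= 0, cond_e c & cond_h c].
Proof.
have [Fmon sF] := monic_Fpoly c.
have [qR a1R a2R a3R [a4R a5R]] := cR; have [u2R u3R u4R] := real_u cR.
have AR : Aval c \is Num.real by rewrite /Aval; real_tac.
have horner5 (P : {poly algC}) x : (5%:R * P).[x] = 5 * P.[x].
  by rewrite mulr_natl hornerMn mulr_natl.
have HR x : x \is Num.real -> Hf c x \is Num.real.
  by move=> xR; rewrite /Hf; real_tac.
have sortX xs : real_rooted (Gpoly c) -> X_ok c xs -> exists g1 g2 g3 g4,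
  [/\ sort <=%R xs = [:: g1; g2; g3; g4], all (mem Num.real) [:: g1; g2; g3; g4],
      [/\ g1 <= g2, g2 <= g3 & g3 <= g4] &
      Gpoly c = \prod_(g <- [:: g1; g2; g3; g4]) ('X - g%:P)].
  move=> Grr xok; have xR := X_ok_real Grr xok; have Gxs := X_ok_prod xok.
  have pxs : perm_eq (sort <=%R xs) xs by rewrite perm_sort.
  have xsS := real_sort_sorted xR.
  have xsR : all (mem Num.real) (sort <=%R xs) by rewrite (perm_all _ pxs).
  have Gs : Gpoly c = \prod_(x <- sort <=%R xs) ('X - x%:P).
    by rewrite (perm_big _ pxs).
  have : size (sort <=%R xs) = 4.
    by have [_] := monic_Gpoly c; rewrite Gs size_prod_XsubC => -[].
  move: xsS xsR Gs {pxs}.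
  case: (sort _ _) => [|g1 [|g2 [|g3 [|g4 []]]]] //= xsS xsR Gs _.
  exists g1, g2, g3, g4; split=> //.
  by move: xsS => /and4P[? ? ? _].
(* The maximum and the minimum split into four sign conditions on F; the order of [algC] is partial,
   so the values of H must first be known to be comparable. *)
have hE xs g1 g2 g3 g4 : sort <=%R xs = [:: g1; g2; g3; g4] ->
    all (mem Num.real) [:: g1; g2; g3; g4] ->
    Num.max (Hf c (sort <=%R xs)`_0) (Hf c (sort <=%R xs)`_2) + Aval c <= c5 c
      <= Num.min (Hf c (sort <=%R xs)`_1) (Hf c (sort <=%R xs)`_3) + Aval c
    <-> [/\ 0 <= (Fpoly c).[g1], (Fpoly c).[g2] <= 0, 0 <= (Fpoly c).[g3]
          & (Fpoly c).[g4] <= 0].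
  move=> -> /and5P[/= g1R g2R g3R g4R _].
  rewrite !Fpoly_Hf !subr_ge0 !subr_le0 -lerBrDr -[c5 c <= _ + _]lerBlDr.
  rewrite comparable_ge_max ?real_comparable ?HR //.
  rewrite comparable_le_min ?real_comparable ?HR //.
  by split=> [/andP[/andP[? ?] /andP[? ?]]|[-> -> -> ->]].
split=> [Frr|[D0 ce ch]].
  have Grr := real_rooted_FG Frr; have [D0 ce] := proj1 Gpoly_condsP Grr.
  split=> // xs xok.
  have [g1 [g2 [g3 [g4 [sE gR [le12 le23 le34] Gg]]]]] := sortX xs Grr xok.
  have le13 := le_trans le12 le23; have le24 := le_trans le23 le34.
  have le14 := le_trans le12 le24.
  have [h21 [h31 [h41 [h32 [h42 h43]]]]] : 0 <= g2 - g1 /\ 0 <= g3 - g1 /\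
      0 <= g4 - g1 /\ 0 <= g3 - g2 /\ 0 <= g4 - g2 /\ 0 <= g4 - g3.
    by rewrite !subr_ge0.
  have F'' : (Fpoly c)^`()^`() = 5%:R * (Gpoly c)^`().
    by rewrite deriv_Fpoly !mulr_natl derivMn.
  have crit g : g \in [:: g1; g2; g3; g4] -> (Fpoly c)^`().[g] = 0.
    rewrite -root_prod_XsubC -Gg => /rootP Gg0.
    by rewrite deriv_Fpoly horner5 Gg0 mulr0.
  have G'E g : (Gpoly c)^`().[g] =
      (g - g2) * (g - g3) * (g - g4) + (g - g1) * (g - g3) * (g - g4)
      + (g - g1) * (g - g2) * (g - g4) + (g - g1) * (g - g2) * (g - g3).
    rewrite Gg !big_cons big_nil mulr1 !derivM !derivXsubC.
    by rewrite !(hornerXsubC, hornerD, hornerM, hornerC); ring.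
  apply/(hE xs _ _ _ _ sE gR); case/and5P: gR => /= g1R g2R g3R g4R _; split.
  - apply: local_max_ge0 Fmon _ Frr g1R _ _; rewrite ?sF ?crit ?inE ?eqxx ?orbT //.
    rewrite F'' horner5 G'E mulr_ge0_le0 ?ler0n //.
    rewrite [X in X <= 0](_ : _ = - ((g2 - g1) * (g3 - g1) * (g4 - g1))); last by ring.
    by rewrite oppr_le0 !mulr_ge0.
  - apply: local_min_le0 Fmon _ Frr g2R _ _; rewrite ?sF ?crit ?inE ?eqxx ?orbT //.
    rewrite F'' horner5 G'E mulr_ge0 ?ler0n //.
    by rewrite [X in 0 <= X](_ : _ = (g2 - g1) * (g3 - g2) * (g4 - g2)) ?mulr_ge0 //;
      ring.
  - apply: local_max_ge0 Fmon _ Frr g3R _ _; rewrite ?sF ?crit ?inE ?eqxx ?orbT //.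
    rewrite F'' horner5 G'E mulr_ge0_le0 ?ler0n //.
    rewrite [X in X <= 0](_ : _ = - ((g3 - g1) * (g3 - g2) * (g4 - g3))); last by ring.
    by rewrite oppr_le0 !mulr_ge0.
  - apply: local_min_le0 Fmon _ Frr g4R _ _; rewrite ?sF ?crit ?inE ?eqxx ?orbT //.
    rewrite F'' horner5 G'E mulr_ge0 ?ler0n //.
    by rewrite [X in 0 <= X](_ : _ = (g4 - g1) * (g4 - g2) * (g4 - g3)) ?mulr_ge0 //;
      ring.
have Grr : real_rooted (Gpoly c) by apply/Gpoly_condsP.
have [xs xok] := X_ok_exists c.
have [g1 [g2 [g3 [g4 [sE gR [le12 le23 le34] Gg]]]]] := sortX xs Grr xok.
have /(hE xs _ _ _ _ sE gR)[F1 F2 F3 F4] := ch xs xok.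
case/and5P: gR => /= g1R g2R g3R g4R _.
apply: (quintic_real_rooted conj_Fpoly Fmon sF _ g1R g2R g3R g4R) => //.
by rewrite deriv_Fpoly Gg !big_cons big_nil mulr1 !mulrA.
Qed.
End RealRootedQuintic.

(** * Weil polynomials and traces *)

Definition intC : {poly int} -> {poly algC} := map_poly (fun c : int => c%:~R).

Definition bounded_by (m y : algC) : bool := (y \is Num.real) && (`|y| <= m).

(** Each factor is (X - w)(X - conj(w)) with w conj(w) = q, recorded by its trace y = w +
    conj(w). *)
Definition weil_prod (q : algC) (ys : seq algC) : {poly algC} :=
  \prod_(y <- ys) ('X^2 - y%:P * 'X + q%:P).

Lemma weil_factor (q : algC) (w : algC) : 0 < q -> `|w| = sqrtC q ->
  ('X - w%:P) * ('X - (w^*)%:P) = 'X^2 - (w + w^*)%:P * 'X + q%:P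
  /\ bounded_by (2 * sqrtC q) (w + w^*).
Proof.
move=> q0 wq; have qE : q = w * w^* by rewrite -normCK wq sqrtCK.
split; first by rewrite qE; ring.
apply/andP; split; first by rewrite CrealE rmorphD /= conjCK addrC.
by rewrite (le_trans (ler_normD _ _)) // norm_conjC wq mulr_natl mulr2n.
Qed.

Lemma weil_factor_exists (q y : algC) : 0 < q -> bounded_by (2 * sqrtC q) y ->
  exists2 w, `|w| = sqrtC q & y = w + w^*.
Proof.
move=> q0 /andP[yR yq].
have d0 : 0 <= 4 * q - y ^+ 2.
  rewrite subr_ge0 -(real_normK yR).
  have -> : 4 * q = (2 * sqrtC q) ^+ 2 by rewrite exprMn sqrtCK; ring.
  by rewrite lerXn2r // nnegrE // mulr_ge0 ?ler0n // sqrtC_ge0 ltW.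
(* The root w = (y + i d) / 2 of X^2 - y X + q serves; d is real by the bound on y, so the other
   root is the conjugate of w. *)
pose d := sqrtC (4 * q - y ^+ 2).
have dC : d^* = d by apply: conj_Creal; rewrite ger0_real // sqrtC_ge0.
have yC := conj_Creal yR.
have wC : ((y + 'i * d) / 2)^* = (y - 'i * d) / 2.
  by rewrite rmorphM fmorphV rmorph_nat rmorphD rmorphM /= conjCi yC dC; ring.
exists ((y + 'i * d) / 2); last by rewrite wC; field.
apply/eqP; rewrite -(@eqrXn2 _ 2) ?normr_ge0 ?sqrtC_ge0 ?(ltW q0) //.
rewrite normCK wC sqrtCK; apply/eqP.
have i2 := @sqrCi algC.
have d2 : d ^+ 2 = 4 * q - y ^+ 2 by rewrite sqrtCK.
by field: i2 d2.
Qed.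

Lemma prod_seq5 (R : comNzRingType) (a b c d e : R) :
  \prod_(r <- [:: a; b; c; d; e]) ('X - r%:P) =
  Poly [:: - (a * b * c * d * e);
    a * b * c * d + a * b * c * e + a * b * d * e + a * c * d * e + b * c * d * e;
    - (a * b * c + a * b * d + a * b * e + a * c * d + a * c * e + a * d * e
       + b * c * d + b * c * e + b * d * e + c * d * e);
    a * b + a * c + a * d + a * e + b * c + b * d + b * e + c * d + c * e + d * e;
    - (a + b + c + d + e); 1].
Proof. by rewrite !big_cons big_nil !PolyE; ring. Qed.

Lemma weil_prod_seq5 (q a b c d e : algC) :
  let e1 := a + b + c + d + e in
  let e2 := a * b + a * c + a * d + a * e + b * c + b * d + b * e + c * d
    + c * e + d * e in
  let e3 := a * b * c + a * b * d + a * b * e + a * c * d + a * c * e + a * d * e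
       + b * c * d + b * c * e + b * d * e + c * d * e in
  let e4 := a * b * c * d + a * b * c * e + a * b * d * e + a * c * d * e
       + b * c * d * e in
  let e5 := a * b * c * d * e in
  let h1 := - e1 in let h2 := e2 + 5 * q in let h3 := - e3 - 4 * q * e1 in
  let h4 := e4 + 3 * q * e2 + 10 * q ^+ 2 in
  let h5 := - e5 - 2 * q * e3 - 6 * q ^+ 2 * e1 in
  weil_prod q [:: a; b; c; d; e] =
    Poly [:: q ^+ 5; h1 * q ^+ 4; h2 * q ^+ 3; h3 * q ^+ 2; h4 * q; h5;
             h4; h3; h2; h1; 1].
Proof.
move=> e1 e2 e3 e4 e5 h1 h2 h3 h4 h5.
rewrite /weil_prod !big_cons big_nil !PolyE /h1 /h2 /h3 /h4 /h5.
by rewrite /e1 /e2 /e3 /e4 /e5; ring.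
Qed.

(** * Bounds on the traces *)

Definition hpolyC (c : coefs) : {poly algC} :=
  Poly [:: cq c ^+ 5; c1 c * cq c ^+ 4; c2 c * cq c ^+ 3; c3 c * cq c ^+ 2;
           c4 c * cq c; c5 c; c4 c; c3 c; c2 c; c1 c; 1].

Lemma hpolyC_weil_prod c ys : size ys = 5 ->
  hpolyC c = weil_prod (cq c) ys <->
  fpoly c = \prod_(y <- ys) ('X - y%:P).
Proof.
case: ys => [|x1 [|x2 [|x3 [|x4 [|x5 []]]]]] // _.
have := weil_prod_seq5 (cq c) x1 x2 x3 x4 x5; cbv zeta => ->.
rewrite /hpolyC /fpoly prod_seq5.
set e1 := x1 + x2 + x3 + x4 + x5.
set e2 := x1 * x2 + _ + _ + _ + _ + _ + _ + _ + _ + _.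
set e3 := x1 * x2 * x3 + _ + _ + _ + _ + _ + _ + _ + _ + _.
set e4 := x1 * x2 * x3 * x4 + _ + _ + _ + _.
set e5 := x1 * x2 * x3 * x4 * x5.
split=> /Poly_inj/(_ erefl).
  by case=> _ _ _ _ -> -> -> -> ->; congr Poly; congr [:: _; _; _; _; _; _]; ring.
(* The coefficients of f are triangular in those of h, so the latter are recovered one after the
   other, starting from a_1. *)
case=> E5 E4 E3 E2 E1.
have E2' : c2 c = e2 + 5 * cq c by rewrite -E2; ring.
have E3' : c3 c = - e3 - 4 * cq c * e1.
  by rewrite -[LHS](subrK (4 * cq c * c1 c)) E3 E1; ring.
have E4' : c4 c = e4 + 3 * cq c * e2 + 10 * cq c ^+ 2.
  have -> : c4 c = (c4 c - 3 * cq c * c2 c + 5 * cq c ^+ 2)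
    + 3 * cq c * c2 c - 5 * cq c ^+ 2 by ring.
  by rewrite E4 E2'; ring.
have E5' : c5 c = - e5 - 2 * cq c * e3 - 6 * cq c ^+ 2 * e1.
  have -> : c5 c = (c5 c - 2 * cq c * c3 c + 2 * cq c ^+ 2 * c1 c)
    + 2 * cq c * c3 c - 2 * cq c ^+ 2 * c1 c by ring.
  by rewrite E5 E3' E1; ring.
by rewrite E1 E2' E3' E4' E5'.
Qed.

(* The normalized Taylor coefficients of s * [fpoly] at s * 2 sqrt q, where
   s = 1 or s = -1; condition (a), (b-star), (d), (f), (g) say that they are
   nonnegative. *)
Definition taylor (c : coefs) (s : algC) : seq algC :=
  let r := sq c in let q := cq c in
  [:: s * c5 c + 2 * r * c4 c + 2 * q * (s * c3 c) + 2 * q * r * c2 c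
        + 2 * q ^+ 2 * (s * c1 c) + 2 * q ^+ 2 * r;
      c4 c + 9 * q * c2 c + 25 * q ^+ 2 + 4 * r * (4 * q * (s * c1 c) + s * c3 c);
      s * c3 c + 6 * r * c2 c + 20 * q * (s * c1 c) + 50 * q * r;
      c2 c + 35 * q + 8 * r * (s * c1 c);
      10 * r + s * c1 c;
      1].

Lemma taylorE c s x : s ^+ 2 = 1 ->
  (Poly (taylor c s)).[x] = s * (fpoly c).[s * (x + 2 * sq c)].
Proof.
move=> s2; have r2 : cq c = sq c ^+ 2 by rewrite sqrtCK.
rewrite /taylor /fpoly r2 !horner_PolyE.
have s3 : s ^+ 3 = s by rewrite exprS s2 mulr1.
by ring: s2.
Qed.

Lemma horner_inj (F : numFieldType) (P Q : {poly F}) :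
  (forall x, P.[x] = Q.[x]) -> P = Q.
Proof.
move=> PQ; apply/eqP; rewrite -subr_eq0; apply/negP=> /negP D0.
have := max_poly_roots D0 (rs := map (fun n => n%:R) (iota 0 (size (P - Q)))).
rewrite size_map size_iota ltnn => H; suff: false by []; apply: H.
  by apply/allP=> x _; rewrite rootE hornerD hornerN PQ subrr.
by rewrite map_inj_uniq ?iota_uniq // => m n /eqP; rewrite eqr_nat => /eqP.
Qed.

(** Pulling s out of each of the five linear factors gives s^6 = 1 in total, so the polynomial has
    the roots s y - 2 sqrt q. *)
Lemma taylor_prod c s ys : s ^+ 2 = 1 -> size ys = 5 ->
  fpoly c = \prod_(y <- ys) ('X - y%:P) ->
  Poly (taylor c s) = \prod_(y <- ys) ('X + (2 * sq c - s * y)%:P).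
Proof.
move=> s2; case: ys => [|x1 [|x2 [|x3 [|x4 [|x5 []]]]]] // _ fE.
apply: horner_inj => x; rewrite taylorE // fE !big_cons !big_nil.
rewrite !mulr1 !(hornerM, hornerXsubC, hornerD, hornerX, hornerC).
have s1 y : x + (2 * sq c - s * y) = s * (s * (x + 2 * sq c) - y).
  by rewrite mulrBr mulrA -expr2 s2; ring.
rewrite !s1; set a := _ - x1; set b := _ - x2; set d := _ - x3.
set e := _ - x4; set g := _ - x5.
rewrite [RHS](_ : _ = (s ^+ 2) ^+ 2 * s * (a * b * d * e * g)); last by ring.
by rewrite s2; ring.
Qed.

Lemma coef_prod_XaddC_ge0 (R : numDomainType) (ds : seq R) i :
  all (>= 0) ds -> 0 <= (\prod_(d <- ds) ('X + d%:P))`_i.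
Proof.
elim: ds i => [|d ds IHds] i /=; first by rewrite big_nil coef1 ler0n.
case/andP=> d0 ds0; rewrite big_cons mulrDl coefD coefXM coefCM.
by rewrite addr_ge0 ?mulr_ge0 ?IHds //; case: eqP => _ //; apply: IHds.
Qed.

Lemma coef_prod_XaddC_gt0 (R : numDomainType) (ds : seq R) i :
  all (> 0) ds -> (i <= size ds)%N -> 0 < (\prod_(d <- ds) ('X + d%:P))`_i.
Proof.
elim: ds i => [|d ds IHds] i /=; first by rewrite big_nil coef1 leqn0 ltr0n lt0b.
case/andP=> d0 ds0 le_i; rewrite big_cons mulrDl coefD coefXM coefCM.
case: i le_i => [|i] le_i /=; first by rewrite add0r mulr_gt0 ?IHds.
rewrite ltr_pwDl ?IHds // (mulr_ge0 (ltW d0)) // coef_prod_XaddC_ge0 //.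
by apply/allP=> x /(allP ds0); apply: ltW.
Qed.

Lemma real_norm_leP (R : numDomainType) (x m : R) : x \is Num.real ->
  (`|x| <= m) = (0 <= m + x) && (0 <= m - x).
Proof. by move=> xR; rewrite real_ler_norml // subr_ge0 -[m + x]addrC -lerBlDr sub0r. Qed.

Lemma taylor_plus c : taylor c 1 =
  [:: c5 c - g_low c;
      c4 c + 9 * cq c * c2 c + 25 * cq c ^+ 2
        + 4 * sq c * (4 * cq c * c1 c + c3 c);
      c3 c - d_low c; c2 c + 35 * cq c + 8 * sq c * c1 c; 10 * sq c + c1 c; 1].
Proof. by rewrite /taylor /g_low /d_low; congr [:: _; _; _; _; _; _]; ring. Qed.

Lemma taylor_minus c : taylor c (-1) =
  [:: g_up c - c5 c;
      c4 c + 9 * cq c * c2 c + 25 * cq c ^+ 2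
        - 4 * sq c * (4 * cq c * c1 c + c3 c);
      d_up c - c3 c; c2 c + 35 * cq c - 8 * sq c * c1 c; 10 * sq c - c1 c; 1].
Proof. by rewrite /taylor /g_up /d_up; congr [:: _; _; _; _; _; _]; ring. Qed.

Lemma horner_Poly_gt0 (R : numDomainType) (s : seq R) (x : R) :
  0 < x -> all (>= 0) s -> 0 < last 0 s -> 0 < (Poly s).[x].
Proof.
move=> x0; elim: s => [|a [|b s] IHs]; first by rewrite ltxx.
  by rewrite !horner_PolyE /= mul0r add0r.
rewrite horner_PolyE => /andP[a0 s0] s1.
by rewrite ltr_pwDl ?mulr_gt0 ?IHs.
Qed.

Section Bounds.
Variable c : coefs.
Hypotheses (cR : real_coefs c) (q_gt0 : 0 < cq c).

Let r_gt0 : 0 < sq c. Proof. by rewrite sqrtC_gt0. Qed.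
Let rR : sq c \is Num.real. Proof. by rewrite gtr0_real. Qed.

Let norm_scaledP (k x a b : algC) : 0 < k -> x \is Num.real ->
  (k * `|x| - b <= a) = (0 <= a + b + k * x) && (0 <= a + b - k * x).
Proof.
move=> k0 xR; have kxR : k * x \is Num.real by rewrite realM // gtr0_real.
by rewrite -(real_norm_leP _ kxR) normrM gtr0_norm // lerBlDr.
Qed.

(** An absolute value in (a), (b-star) or (f) yields one coefficient for each sign s; in (d) and (g)
    the lower bound belongs to s = 1 and the upper one to s = -1. *)
Lemma taylor_ge0P :
  [/\ cond_a c, cond_bs c, cond_d c, cond_f c & cond_g c] <->
  all (>= 0) (taylor c 1) /\ all (>= 0) (taylor c (-1)).
Proof.
have [qR a1R a2R a3R [a4R a5R]] := cR.
have aE : cond_a c = (0 <= 10 * sq c + c1 c) && (0 <= 10 * sq c - c1 c).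
  by rewrite /cond_a real_norm_leP.
have bE : cond_bs c = (0 <= c2 c + 35 * cq c + 8 * sq c * c1 c)
                   && (0 <= c2 c + 35 * cq c - 8 * sq c * c1 c).
  by rewrite /cond_bs norm_scaledP // mulr_gt0 ?ltr0n.
have fE : cond_f c = (0 <= c4 c + 9 * cq c * c2 c + 25 * cq c ^+ 2
                           + 4 * sq c * (4 * cq c * c1 c + c3 c))
                  && (0 <= c4 c + 9 * cq c * c2 c + 25 * cq c ^+ 2
                           - 4 * sq c * (4 * cq c * c1 c + c3 c)).
  rewrite /cond_f /f_low -addrA -opprD norm_scaledP ?mulr_gt0 ?ltr0n //.
    by rewrite addrA.
  by real_tac.
rewrite aE bE fE /cond_d /cond_g -(subr_ge0 (d_low c)) -(subr_ge0 (c3 c)).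
rewrite -(subr_ge0 (g_low c)) -(subr_ge0 (c5 c)).
have allE (x1 x2 x3 x4 x5 : algC) : all (>= 0) [:: x1; x2; x3; x4; x5; 1] =
    [&& 0 <= x1, 0 <= x2, 0 <= x3, 0 <= x4 & 0 <= x5].
  by rewrite /= ler01 !andbT.
rewrite taylor_plus taylor_minus !allE.
split=> [[/andP[-> ->] /andP[-> ->] /andP[-> ->] /andP[-> ->] /andP[-> ->]] //|].
by case=> /and5P[-> -> -> -> ->] /and5P[-> -> -> -> ->].
Qed.

Section Roots.
Variable ys : seq algC.
Hypotheses (sys : size ys = 5) (ysR : all (mem Num.real) ys).
Hypothesis fE : fpoly c = \prod_(y <- ys) ('X - y%:P).

(** For bounded roots the coefficients are symmetric functions of nonnegative numbers. Conversely, s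
    y > 2 sqrt q would give a positive root of a monic polynomial with nonnegative coefficients. *)
Lemma taylor_ge0_bounded : all (bounded_by (2 * sq c)) ys <->
  all (>= 0) (taylor c 1) /\ all (>= 0) (taylor c (-1)).
Proof.
have pos s : s ^+ 2 = 1 -> all (fun y => 0 <= 2 * sq c - s * y) ys ->
    all (>= 0) (taylor c s).
  move=> s2 ys0; apply/(all_nthP 0) => i _.
  rewrite -coef_Poly (taylor_prod s2 sys fE).
  rewrite -(big_map (fun y => 2 * sq c - s * y) xpredT (fun d => 'X + d%:P)).
  by apply: coef_prod_XaddC_ge0; rewrite all_map.
have neg s y : s ^+ 2 = 1 -> s \is Num.real -> all (>= 0) (taylor c s) ->
    y \in ys -> s * y <= 2 * sq c.
  move=> s2 sR tay y_ys; have yR : y \is Num.real := allP ysR _ y_ys.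
  rewrite real_leNgt ?realM ?realn //; apply/negP; rewrite -subr_gt0 => x0.
  have := taylorE c (s * y - 2 * sq c) s2.
  rewrite subrK mulrA -expr2 s2 mul1r fE.
  have /rootP-> : root (\prod_(y <- ys) ('X - y%:P)) y by rewrite root_prod_XsubC.
  rewrite mulr0 => /eqP; apply/negP/lt0r_neq0.
  by apply: horner_Poly_gt0; rewrite // /taylor /= ltr01.
split=> [ysb|[p m]].
  split; apply: pos; rewrite ?expr1n ?sqrrN ?expr1n //.
    by apply/allP=> y /(allP ysb)/andP[yR]; rewrite real_norm_leP // mul1r => /andP[].
  apply/allP=> y /(allP ysb)/andP[yR]; rewrite real_norm_leP // mulN1r opprK.
  by case/andP.
apply/allP=> y y_ys; have yR : y \is Num.real := allP ysR _ y_ys.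
rewrite /bounded_by yR /= real_norm_leP //.
have y1 : 1 * y <= 2 * sq c by apply: neg => //; rewrite ?expr1n ?real1.
have y2 : (-1) * y <= 2 * sq c.
  by apply: neg => //; rewrite ?sqrrN ?expr1n ?realN ?real1.
rewrite mul1r -subr_ge0 in y1; rewrite mulN1r -subr_ge0 opprK in y2.
by rewrite y1 y2.
Qed.

(** If no 2 sqrt q - s y vanished, all would be positive, and so would every coefficient. *)
Lemma taylor_eq0 s : s ^+ 2 = 1 -> s \is Num.real ->
  all (bounded_by (2 * sq c)) ys ->
  0 \in taylor c s -> exists2 y, y \in ys & s * y = 2 * sq c.
Proof.
move=> s2 sR ysb t0;
have [/hasP[y y_ys /eqP sy]|] := boolP (has (fun y => s * y == 2 * sq c) ys).
  by exists y.
rewrite -all_predC => /allP ysN; exfalso.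
pose ds := map (fun y => 2 * sq c - s * y) ys.
have ds0 : all (> 0) ds.
  apply/allP=> _ /mapP[y y_ys ->]; have /andP[yR yb] := allP ysb y y_ys.
  have := ysN y y_ys; rewrite /= subr_gt0 lt_neqAle => -> /=.
  apply: le_trans (real_ler_norm (realM sR yR)) _; rewrite normrM.
  suff /eqP -> : `|s| == 1 by rewrite mul1r.
  by rewrite -(@eqrXn2 _ 2) ?ler01 // -normrX s2 normr1 expr1n.
have lt_i : (index 0%R (taylor c s) < size (taylor c s))%N by rewrite index_mem.
have := coef_prod_XaddC_gt0 (i := index 0%R (taylor c s)) ds0.
rewrite size_map sys big_map -(taylor_prod s2 sys fE) coef_Poly nth_index //.
by rewrite ltxx => /(_ lt_i).
Qed.

Lemma taylor0_eq0 s y : s ^+ 2 = 1 -> y \in ys -> s * y = 2 * sq c ->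
  (taylor c s)`_0 = 0.
Proof.
move=> s2 y_ys sy; have := taylorE c 0 s2.
rewrite horner_coef0 coef_Poly add0r -sy mulrA -expr2 s2 mul1r fE.
have /rootP-> : root (\prod_(y <- ys) ('X - y%:P)) y by rewrite root_prod_XsubC.
by rewrite mulr0.
Qed.
End Roots.
End Bounds.

(** * Integral factors *)

Lemma monic_weil_prod q ys :
  weil_prod q ys \is monic /\ size (weil_prod q ys) = (2 * size ys).+1.
Proof.
elim: ys => [|y ys [IHm IHs]].
  by rewrite /weil_prod big_nil monic1 size_poly1.
have yE : 'X^2 - y%:P * 'X + q%:P = Poly [:: q; - y; 1] by rewrite !PolyE; ring.
have [ym ysz] := @monic_Poly _ [:: q; - y; 1] erefl.
rewrite /weil_prod big_cons -/(weil_prod q ys) yE; split; first by rewrite monicMl.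
by rewrite size_monicM ?monic_neq0 // ysz IHs mulnS.
Qed.

Lemma intCM p1 p2 : intC (p1 * p2) = intC p1 * intC p2.
Proof. exact: rmorphM. Qed.

Lemma intC_inj : injective intC.
Proof. by apply: map_inj_poly => //; apply: intr_inj. Qed.

Lemma monic_intC p : (intC p \is monic) = (p \is monic).
Proof.
rewrite !monicE /intC lead_coef_map_inj ?rmorph0 //; last exact: intr_inj.
by rewrite -[1 in LHS]/(1%:~R) (inj_eq (@intr_inj _)).
Qed.

Lemma size_intC p : size (intC p) = size p.
Proof. by rewrite /intC size_map_inj_poly ?rmorph0 //; apply: intr_inj. Qed.

Lemma WeilP q g P : (0 < q)%N -> Weil q g P <->
  exists ys, [/\ size ys = g, all (bounded_by (2 * sqrtC q%:R)) ys
               & intC P = weil_prod q%:R ys].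
Proof.
move=> q_gt0; have q0 : 0 < q%:R :> algC by rewrite ltr0n.
split=> [[_ [_ [w [sw [wq PE]]]]]|[ys [sys ysb PE]]].
  exists (map (fun z => z + z^*) w); split; first by rewrite size_map.
    by apply/allP => _ /mapP[z /wq zq ->]; have [] := weil_factor q0 zq.
  rewrite [LHS]PE /weil_prod big_map; apply: eq_big_seq => z /wq zq.
  by have [] := weil_factor q0 zq.
have [wm ws] := monic_weil_prod q%:R ys.
split; first by rewrite -monic_intC PE.
split; first by rewrite -size_intC PE ws sys.
suff [w [sw wq wE]] : exists w, [/\ size w = size ys,
    forall z, z \in w -> `|z| = sqrtC q%:R & ys = map (fun z => z + z^*) w].
  exists w; rewrite sw sys; do !split=> //.
  rewrite -/(intC P) PE wE /weil_prod big_map; apply: eq_big_seq => z /wq zq.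
  by have [] := weil_factor q0 zq.
elim: ys ysb {sys PE wm ws} => [|y ys IHys] /=; first by exists [::].
case/andP=> /(weil_factor_exists q0)[z zq ->] /IHys[w [sw wq ->]].
exists (z :: w); split=> //=; first by rewrite size_map.
by move=> x; rewrite inE => /orP[/eqP ->|/wq].
Qed.

(** Division by a monic polynomial stays in Z[x]. The remainder is a multiple of d over [algC] of
    smaller degree, hence zero. *)
Lemma intC_dvd (h d : {poly int}) (g : {poly algC}) : d \is monic ->
  intC h = intC d * g -> exists2 h0, h = d * h0 & intC h0 = g.
Proof.
move=> dm hE; have hdiv := Pdiv.RingMonic.rdivp_eq dm h.
set k := Pdiv.CommonRing.rdivp h d in hdiv.
set r := Pdiv.CommonRing.rmodp h d in hdiv.
have rE : intC r = (g - intC k) * intC d.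
  have : intC h = intC k * intC d + intC r by rewrite {1}hdiv /intC rmorphD rmorphM.
  by rewrite hE => e; rewrite mulrBl [g * _]mulrC e; ring.
have dCm : intC d \is monic by rewrite monic_intC.
have gk : g - intC k = 0.
  apply/eqP; apply: contraTT isT => gk0.
  have : (size r < size d)%N by rewrite Pdiv.Ring.ltn_rmodp monic_neq0.
  rewrite -(size_intC r) rE size_Mmonic // size_intC.
  have : (0 < size d)%N by rewrite size_poly_gt0 monic_neq0.
  rewrite -size_poly_gt0 in gk0; case: (size _) gk0 => // n _; case: (size d) => // m _.
  by rewrite addSn /= addnS !ltnS ltnNge leq_addl.
exists k; last by apply/eqP; rewrite eq_sym -subr_eq0 gk.
have r0 : r = 0 by apply: intC_inj; rewrite rE gk mul0r /intC rmorph0.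
by rewrite {1}hdiv r0 addr0 mulrC.
Qed.

Section WeilFactor.
Variables (q : nat) (d : {poly int}) (es : seq algC).
Hypotheses (q_gt0 : (0 < q)%N) (dE : intC d = weil_prod q%:R es).
Hypothesis esb : all (bounded_by (2 * sqrtC q%:R)) es.

Lemma Weil_mul g h0 : Weil q g h0 -> Weil q (size es + g) (d * h0).
Proof.
move=> /(WeilP _ _ q_gt0)[ys [sys ysb h0E]]; apply/WeilP => //; exists (es ++ ys).
rewrite size_cat sys all_cat esb ysb; split=> //.
by rewrite intCM dE h0E /weil_prod big_cat.
Qed.

Lemma Weil_div h ys ys' : perm_eq ys (es ++ ys') ->
  all (bounded_by (2 * sqrtC q%:R)) ys -> intC h = weil_prod q%:R ys ->
  exists2 h0, Weil q (size ys') h0 & h = d * h0.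
Proof.
move=> pys ysb hE.
have dm : d \is monic by have [] := monic_weil_prod q%:R es; rewrite -dE monic_intC.
have [|h0 hd h0E] := @intC_dvd h d (weil_prod q%:R ys') dm.
  by rewrite hE dE /weil_prod (perm_big _ pys) big_cat.
exists h0 => //; apply/WeilP => //; exists ys'; split=> //.
by move: ysb; rewrite (perm_all _ pys) all_cat => /andP[].
Qed.
End WeilFactor.

(** The factor X^2 - y X + q has discriminant y^2 - 4 q <= 0, so a real root forces equality; the
    root is then y / 2. *)
Lemma weil_prod_real_root (q : algC) ys : 0 < q ->
  all (bounded_by (2 * sqrtC q)) ys ->
  (exists2 x, x \is Num.real & root (weil_prod q ys) x) <->
  (exists2 y, y \in ys & y = 2 * sqrtC q \/ y = - (2 * sqrtC q)).
Proof.
move=> q0 /allP ysb; split=> [[x xR /rootP]|[y y_ys yE]].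
  rewrite /weil_prod horner_prod => /eqP; rewrite prodf_seq_eq0 => /hasP[y y_ys].
  rewrite /= !(hornerD, hornerN, hornerM, hornerC, hornerXn, hornerX) => /eqP xy.
  have /andP[yR yb] := ysb y y_ys; exists y => //; apply/pred2P.
  have r0 : 0 <= 2 * sqrtC q by rewrite mulr_ge0 ?ler0n // sqrtC_ge0 ltW.
  rewrite /= -eqf_sqr eq_le -(real_normK yR) lerXn2r ?nnegrE // (real_normK yR).
  rewrite exprMn sqrtCK -subr_ge0 [X in 0 <= X](_ : _ =
    (2 * x - y) ^+ 2 - 4 * (x ^+ 2 - y * x + q)); last by ring.
  by rewrite xy mulr0 subr0 real_exprn_even_ge0 //; real_tac.
have yR : y \is Num.real by have /andP[] := ysb y y_ys.
exists (y / 2); first by real_tac.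
apply/rootP; rewrite /weil_prod horner_prod; apply/eqP; rewrite prodf_seq_eq0.
apply/hasP; exists y => //=.
rewrite !(hornerD, hornerN, hornerM, hornerC, hornerXn, hornerX); apply/eqP.
by move: (sqrtC q) (sqrtCK q) yE => r <- [] ->; field.
Qed.

(** If b is nonzero, a^2 = q b^2 makes b divide a, and q is the square of the quotient. *)
Lemma nonsquare_sqrtC_free q (a b : int) : ~ is_square q ->
  a%:~R + b%:~R * sqrtC q%:R = 0 :> algC -> a = 0 /\ b = 0.
Proof.
move=> qN ab0; have [b0|b0] := eqVneq b 0.
  by move/eqP: ab0; rewrite b0 mul0r addr0 intr_eq0 => /eqP.
case: qN; have : a ^+ 2 = q%:Z * b ^+ 2.
  apply: (@intr_inj algC); rewrite !expr2 !intrM.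
  have -> : a%:~R = - (b%:~R * sqrtC q%:R) :> algC by apply/eqP; rewrite -addr_eq0 ab0.
  by rewrite mulrNN mulrACA -expr2 mulrC -expr2 sqrtCK.
move=> /(congr1 absz); rewrite abszM !abszX /= => e.
have : (`|b| ^ 2 %| `|a| ^ 2)%N by rewrite e dvdn_mull.
rewrite dvdn_pexp2r // => /dvdnP[m am]; exists m.
have b1 : (0 < `|b| ^ 2)%N by rewrite expn_gt0 absz_gt0 b0.
by apply/eqP; rewrite -(eqn_pmul2r b1) -e am expnMn.
Qed.

Lemma real_rooted_fpoly c : c1 c \is Num.real ->
  real_rooted (fpoly c) <-> real_rooted (Fpoly c).
Proof.
move=> a1R; have sR : c1 c / 5 \is Num.real by real_tac.
split=> rr z /rootP Pz.
  rewrite -[z](subrK (c1 c / 5)) realD // rr //; apply/rootP.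
  by rewrite fpoly_shift subrK.
rewrite -[z](addrK (c1 c / 5)) realD ?realN // rr //; apply/rootP.
by rewrite -fpoly_shift.
Qed.

(** * Integer coefficients and the conditions (a) to (h) *)

Section IntegerCoefficients.
Variables (q : nat) (a1 a2 a3 a4 a5 : int).
Hypothesis q_gt0 : (0 < q)%N.

Let C := Coefs q%:R a1%:~R a2%:~R a3%:~R a4%:~R a5%:~R.
Let h := hpoly q a1 a2 a3 a4 a5.

Let qC_gt0 : 0 < cq C. Proof. by rewrite /= ltr0n. Qed.

Let CR : real_coefs C.
Proof.
by split; rewrite /= ?realn ?Rreal_int ?intr_int //;
   split; rewrite Rreal_int ?intr_int.
Qed.

Lemma intC_hpoly : intC h = hpolyC C.
Proof.
rewrite /intC /h /hpoly map_Poly_id0 ?rmorph0 // /hpolyC.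
congr Poly; rewrite /=; congr [:: _; _; _; _; _; _; _; _; _; _; _];
by rewrite ?intrM ?rmorphXn.
Qed.

Lemma Weil_fpolyP : Weil q 5 h <-> exists ys, [/\ size ys = 5,
  all (bounded_by (2 * sqrtC q%:R)) ys & fpoly C = \prod_(y <- ys) ('X - y%:P)].
Proof.
split=> [/(WeilP _ _ q_gt0)|] [ys [sys ysb]].
  by rewrite intC_hpoly => /(hpolyC_weil_prod C sys) fE; exists ys.
move=> /(hpolyC_weil_prod C sys) hE; apply/WeilP => //.
by exists ys; rewrite intC_hpoly.
Qed.

Lemma bounded_real m ys : all (bounded_by m) ys -> all (mem Num.real) ys.
Proof. by apply: sub_all => y /andP[]. Qed.

Lemma Weil_real_rooted : Weil q 5 h -> real_rooted (Fpoly C).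
Proof.
move=> /Weil_fpolyP[ys [_ /bounded_real ysR fE]].
have [_ a1R _ _ _] := CR.
by apply/real_rooted_fpoly => //; rewrite fE; apply: real_rooted_prod.
Qed.

Lemma conds_ad_Delta : conds_ad q a1 a2 a3 a4 a5 -> Delta C <= 0.
Proof. by move=> [_ [_ [cb [cc _]]]]; apply/(Delta_le0_bc CR). Qed.

Lemma S_all_realP :
  Weil q 5 h \/ conds_ad q a1 a2 a3 a4 a5 -> S_all_real q a1 a2 a3 a4 a5.
Proof.
move=> Wad c0 s sok x xs; have D0 : Delta C <= 0.
  case: Wad => [/Weil_real_rooted/(Fpoly_condsP CR)[] //|]; exact: conds_ad_Delta.
have [bs [bsR _ sE]] := S_ok_roots CR D0 sok; have [u2R u3R _] := real_u CR.
move: xs; rewrite sE => /mapP[b /(allP bsR) /= bR ->].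
by rewrite /theta_of; real_tac.
Qed.

Lemma X_all_realP :
  Weil q 5 h \/ conds_af q a1 a2 a3 a4 a5 -> X_all_real q a1 a2 a3 a4 a5.
Proof.
move=> Waf c0 xs xok x; suff Grr : real_rooted (Gpoly C).
  exact: (allP (X_ok_real Grr xok)).
case: Waf => [/Weil_real_rooted|[/conds_ad_Delta D0 [ce _]]].
  exact: real_rooted_FG.
by apply/(Gpoly_condsP CR).
Qed.

Lemma Weil_condsP : Weil q 5 h <-> conds_ah q a1 a2 a3 a4 a5.
Proof.
have [_ a1R _ _ _] := CR.
split=> [W|[[[ca [cbs [cb [cc cd]]]] [ce cf]] [cg ch]]].
  have [D0 ce ch] := proj1 (Fpoly_condsP CR) (Weil_real_rooted W).
  have /Weil_fpolyP[ys [sys ysb fE]] := W; have ysR := bounded_real ysb.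
  have [cb cc] := proj1 (Delta_le0_bc CR) D0.
  have /(taylor_ge0P CR qC_gt0)[ca cbs cd cf cg] :=
    proj1 (taylor_ge0_bounded qC_gt0 sys ysR fE) ysb.
  by do !split.
have frr : real_rooted (fpoly C).
  apply/real_rooted_fpoly => //; apply/(Fpoly_condsP CR); split=> //.
  by apply/(Delta_le0_bc CR).
have [fmon sf] := monic_fpoly C.
have [ys ysR fE] := real_rooted_splits fmon frr.
have sys : size ys = 5 by move: sf; rewrite fE size_prod_XsubC => -[].
apply/Weil_fpolyP; exists ys; split=> //.
by apply/(taylor_ge0_bounded qC_gt0 sys ysR fE)/taylor_ge0P.
Qed.

Section Traces.
Variable ys : seq algC.
Hypotheses (sys : size ys = 5) (ysb : all (bounded_by (2 * sqrtC q%:R)) ys).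
Hypothesis fE : fpoly C = \prod_(y <- ys) ('X - y%:P).

Let extremal := exists2 y, y \in ys & y = 2 * sqrtC q%:R \/ y = - (2 * sqrtC q%:R).

Lemma has_real_root_extremal : has_real_root h <-> extremal.
Proof.
rewrite /extremal -(weil_prod_real_root _ ysb) ?ltr0n //.
move/(hpolyC_weil_prod C sys): fE => /= hE.
rewrite -hE -intC_hpoly /has_real_root.
by split=> [[x [xR xh]]|[x xR xh]]; exists x.
Qed.

Lemma some_equality_extremal : some_equality q a1 a2 a3 a4 a5 <-> extremal.
Proof.
have [qR a1R a2R a3R [a4R a5R]] := CR.
split=> [eqs|].
  suff : 0 \in taylor C 1 \/ 0 \in taylor C (-1).
    case=> /(taylor_eq0 sys fE)[]; rewrite ?sqrrN ?expr1n ?realN ?real1 //.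
      by move=> y y_ys; rewrite mul1r => yE; exists y; [|left].
    by move=> y y_ys; rewrite mulN1r => yE; exists y; [|right; rewrite -yE opprK].
  have mem0 t i : (i < 6)%N -> (taylor C t)`_i = 0 -> 0 \in taylor C t.
    by move=> lt_i <-; apply: mem_nth.
  have normE x : x \is Num.real -> `|x| = x \/ `|x| = - x :> algC.
    by move=> xR; case: (real_ge0P xR); [left|right].
  (* Conditions (a), (b-star), (d), (f), (g) sit at the indices 4, 3, 2, 1, 0 of [taylor]; the sign
     inside an absolute value selects s. *)
  case: eqs => [e|[e|[e|[e|[e|[e|e]]]]]].
  - case: (normE _ a1R) e => -> e; [right|left]; apply: (mem0 _ 4) => //.
      by rewrite taylor_minus /= -e subrr.
    by rewrite taylor_plus /= -e addNr.
  - case: (normE _ a1R) e => -> e; [right|left]; apply: (mem0 _ 3) => //.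
      by rewrite taylor_minus /= -e; ring.
    by rewrite taylor_plus /= -e; ring.
  - left; apply: (mem0 _ 2) => //; by rewrite taylor_plus /= e subrr.
  - right; apply: (mem0 _ 2) => //; by rewrite taylor_minus /= -e subrr.
  - have xR : 4 * cq C * c1 C + c3 C \is Num.real by real_tac.
    move: e; rewrite /f_low.
    case: (normE _ xR) => -> e; [right|left]; apply: (mem0 _ 1) => //.
      by rewrite taylor_minus /= -e; ring.
    by rewrite taylor_plus /= -e; ring.
  - left; apply: (mem0 _ 0) => //; by rewrite taylor_plus /= e subrr.
  - right; apply: (mem0 _ 0) => //; by rewrite taylor_minus /= -e subrr.
(* An extremal trace already makes a bound in (g) an equality, since the constant coefficient
   vanishes. *)
case=> y y_ys [] yE.
- have := taylor0_eq0 fE (expr1n _ 2) y_ys; rewrite mul1r => /(_ yE).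
  rewrite taylor_plus => /eqP; rewrite subr_eq0 => /eqP e.
  by do 5!right; left; rewrite -e.
- have := taylor0_eq0 (s := -1) fE _ y_ys; rewrite sqrrN expr1n mulN1r yE opprK.
  move=> /(_ erefl erefl); rewrite taylor_minus => /eqP; rewrite subr_eq0 => /eqP e.
  by do 6!right; rewrite e.
Qed.
End Traces.
End IntegerCoefficients.

(** * Real roots *)

Lemma sqrtC_nat_sqr m : sqrtC ((m ^ 2)%N%:R) = m%:R :> algC.
Proof. by rewrite natrX sqrCK ?ler0n. Qed.

Lemma bounded_extremal (r s : algC) : 0 < r -> s = r \/ s = - r -> bounded_by r s.
Proof.
move=> r0 sE; rewrite /bounded_by.
by case: sE => ->; rewrite ?realN ?normrN gtr0_real //= gtr0_norm.
Qed.

Lemma intC_XaddC_sqr m : intC (('X + (m%:Z)%:P) ^+ 2) =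
  weil_prod (m ^ 2)%N%:R [:: - (2 * m%:R)].
Proof.
rewrite /weil_prod big_seq1 /intC rmorphXn rmorphD /= map_polyX map_polyC /=.
by rewrite natrX; ring.
Qed.

Lemma intC_XsubC_sqr m : intC (('X - (m%:Z)%:P) ^+ 2) =
  weil_prod (m ^ 2)%N%:R [:: 2 * m%:R].
Proof.
rewrite /weil_prod big_seq1 /intC rmorphXn rmorphB /= map_polyX map_polyC /=.
by rewrite natrX; ring.
Qed.

Lemma intC_X2subC_sqr q : intC (('X ^+ 2 - (q%:Z)%:P) ^+ 2) =
  weil_prod q%:R [:: 2 * sqrtC q%:R; - (2 * sqrtC q%:R)].
Proof.
rewrite /weil_prod !big_cons big_nil /intC rmorphXn rmorphB rmorphXn /=.
rewrite map_polyX map_polyC /=.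
have -> : (q%:Z)%:~R = q%:R :> algC by [].
by move: (sqrtC _) (sqrtCK (q%:R : algC)) => r <-; ring.
Qed.

Section Cases.
Variables (q : nat) (a1 a2 a3 a4 a5 : int).
Hypothesis q_gt0 : (0 < q)%N.
Let h := hpoly q a1 a2 a3 a4 a5.
Let C := Coefs q%:R a1%:~R a2%:~R a3%:~R a4%:~R a5%:~R.
Let r_gt0 : 0 < 2 * sqrtC (q%:R : algC).
Proof. by rewrite mulr_gt0 ?ltr0n // sqrtC_gt0 ltr0n. Qed.

(* The value at 2 sqrt q is a + b sqrt q and the one at - 2 sqrt q is
   - (a - b sqrt q), with integers a and b. *)
Lemma nonsquare_taylor0 : ~ is_square q ->
  (taylor C 1)`_0 = 0 <-> (taylor C (-1))`_0 = 0.
Proof.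
move=> qN.
pose a := a5 + 2 * q%:Z * a3 + 2 * q%:Z ^+ 2 * a1.
pose b := 2 * a4 + 2 * q%:Z * a2 + 2 * q%:Z ^+ 2.
have aE : a%:~R = a5%:~R + 2 * q%:R * a3%:~R + 2 * q%:R ^+ 2 * a1%:~R :> algC.
  by rewrite /a; ring.
have bE : b%:~R = 2 * a4%:~R + 2 * q%:R * a2%:~R + 2 * q%:R ^+ 2 :> algC.
  by rewrite /b; ring.
have t1 : (taylor C 1)`_0 = a%:~R + b%:~R * sqrtC q%:R.
  by rewrite aE bE /= /sq; ring.
have t2 : (taylor C (-1))`_0 = - (a%:~R + (- b)%:~R * sqrtC q%:R).
  by rewrite rmorphN /= aE bE /= /sq; ring.
rewrite t1 t2; split.
  by case/(nonsquare_sqrtC_free qN) => -> ->; rewrite oppr0 mul0r addr0 oppr0.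
move/eqP; rewrite oppr_eq0 => /eqP/(nonsquare_sqrtC_free qN)[-> /eqP].
by rewrite oppr_eq0 => /eqP->; rewrite mul0r addr0.
Qed.

(** A real root means a trace 2 sqrt q or - 2 sqrt q. For square q its factor is integral and can be
    divided out; for nonsquare q both traces occur, and together they give the integral factor (x^2
    - q)^2. *)
Lemma Weil_real_root_casesP :
  Weil q 5 h /\ has_real_root h <-> caseI q h \/ caseII q h.
Proof.
have rootP es h0 g d : all (bounded_by (2 * sqrtC q%:R)) es -> (0 < size es)%N ->
    (forall e, e \in es -> e = 2 * sqrtC q%:R \/ e = - (2 * sqrtC q%:R)) ->
    intC d = weil_prod q%:R es -> (size es + g = 5)%N -> Weil q g h0 -> h = d * h0 ->
    Weil q 5 h /\ has_real_root h.
  move=> esb es0 esE dE sg W0 hE.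
  have W : Weil q 5 h by rewrite hE -sg; apply: (Weil_mul q_gt0 dE).
  split=> //; have qC0 : 0 < q%:R :> algC by rewrite ltr0n.
  have [_ /(_ _)[]] := weil_prod_real_root qC0 esb.
    case: (es) es0 esE => // e es' _ /(_ e (mem_head _ _)) eE.
    by exists e; rewrite ?mem_head.
  move=> x xR xd; exists x; split=> //.
  by rewrite -/(intC h) hE intCM rootM dE xd.
split=> [[W hr]|]; last first.
  case=> [[m [qE [h0 [W0 hE]]]]|[_ [h0 [W0 hE]]]].
    have rE : sqrtC q%:R = m%:R :> algC by rewrite qE sqrtC_nat_sqr.
    case: hE => hE.
    - apply: (rootP [:: - (2 * sqrtC q%:R)] h0 4 _ _ _ _ _ _ W0 hE) => //=.
      + by rewrite bounded_extremal //; right.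
      + by move=> e; rewrite inE => /eqP->; right.
      + by rewrite rE qE intC_XaddC_sqr.
    - apply: (rootP [:: 2 * sqrtC q%:R] h0 4 _ _ _ _ _ _ W0 hE) => //=.
      + by rewrite bounded_extremal //; left.
      + by move=> e; rewrite inE => /eqP->; left.
      + by rewrite rE qE intC_XsubC_sqr.
  apply: (rootP [:: 2 * sqrtC q%:R; - (2 * sqrtC q%:R)] h0 3 _ _ _ _ _ _ W0 hE) => //=.
  - by rewrite !bounded_extremal //; [right|left].
  - by move=> e; rewrite !inE => /orP[] /eqP->; [left|right].
  - exact: intC_X2subC_sqr.
have /(Weil_fpolyP _ _ _ _ _ q_gt0)[ys [sys ysb fE]] := W.
have hE : intC h = weil_prod q%:R ys.
  by rewrite intC_hpoly; apply/(hpolyC_weil_prod C sys).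
have [y y_ys yE] := proj1 (has_real_root_extremal q_gt0 sys ysb fE) hr.
have pys := perm_to_rem y_ys; have sys' := size_rem y_ys.
(* A square root of q is at most q, so a finite search decides whether q is a square. *)
have [/existsP[m /eqP qE]|qN] := boolP [exists m : 'I_q.+1, q == (m ^ 2)%N].
  left; exists m; split=> //.
  have rE : sqrtC q%:R = m%:R :> algC by rewrite {1}qE sqrtC_nat_sqr.
  have dE d : intC d = weil_prod (m ^ 2)%N%:R [:: y] ->
      exists2 h0, Weil q 4 h0 & h = d * h0.
    rewrite -qE => dE; have := Weil_div q_gt0 dE pys ysb hE.
    by rewrite sys' sys.
  case: yE => yE; rewrite yE rE in dE.
    by have [h0 W0 h0E] := dE _ (intC_XsubC_sqr m); exists h0; split=> //; right.
  by have [h0 W0 h0E] := dE _ (intC_XaddC_sqr m); exists h0; split=> //; left.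
have {}qN : ~ is_square q.
  case=> m qE; move/existsPn: qN => qN; have lt_m : (m < q.+1)%N.
    rewrite ltnS qE -mulnn leq_pmull // lt0n.
    by apply: contraTneq q_gt0 => m0; rewrite qE m0.
  by have := qN (Ordinal lt_m); rewrite /= -qE eqxx.
right; split=> //.
have N1 : (-1) ^+ 2 = 1 :> algC by rewrite sqrrN expr1n.
have [p m] : (taylor C 1)`_0 = 0 /\ (taylor C (-1))`_0 = 0.
  case: yE => yE.
    have p : (taylor C 1)`_0 = 0.
      by apply: (taylor0_eq0 fE (expr1n _ 2) y_ys); rewrite mul1r.
    by split=> //; apply/nonsquare_taylor0.
  have m : (taylor C (-1))`_0 = 0.
    by apply: (taylor0_eq0 fE N1 y_ys); rewrite mulN1r yE opprK.
  by split=> //; apply/nonsquare_taylor0.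
have mem0 t : (taylor C t)`_0 = 0 -> 0 \in taylor C t.
  by move=> <-; apply: mem_nth.
have [y1 y1_ys] := taylor_eq0 sys fE (expr1n _ 2) (real1 _) ysb (mem0 _ p).
have N1R : -1 \is @Num.real algC by rewrite realN real1.
have [y2 y2_ys] := taylor_eq0 sys fE N1 N1R ysb (mem0 _ m).
rewrite mulN1r mul1r => y2E y1E; rewrite -[y2]opprK y2E in y2_ys.
rewrite y1E /= in y1_ys; rewrite /= in y2_ys.
set r2 := 2 * sqrtC q%:R in y1_ys y2_ys.
(* The two traces are distinct because r2 > 0, so the second survives the removal of the first. *)
have y2_rem : - r2 \in rem r2 ys.
  have := y2_ys; rewrite (perm_mem (perm_to_rem y1_ys)) inE => /orP[|//].
  by rewrite eq_sym -addr_eq0 -mulr2n mulrn_eq0 /= gt_eqF.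
have pys2 : perm_eq ys ([:: r2; - r2] ++ rem (- r2) (rem r2 ys)).
  apply: perm_trans (perm_to_rem y1_ys) _.
  by rewrite /= perm_cons; apply: perm_to_rem.
have [h0] := Weil_div q_gt0 (intC_X2subC_sqr q) pys2 ysb hE.
by rewrite !size_rem // sys => W0 h0E; exists h0.
Qed.
End Cases.

Theorem theoremC (p k : nat) (a1 a2 a3 a4 a5 : int) :
  prime p -> (0 < k)%N ->
  let q := (p ^ k)%N in
  let h := hpoly q a1 a2 a3 a4 a5 in
  ((Weil q 5 h \/ conds_ad q a1 a2 a3 a4 a5) -> S_all_real q a1 a2 a3 a4 a5) /\
  ((Weil q 5 h \/ conds_af q a1 a2 a3 a4 a5) -> X_all_real q a1 a2 a3 a4 a5) /\
  (Weil q 5 h <-> conds_ah q a1 a2 a3 a4 a5) /\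
  (Weil q 5 h -> (has_real_root h <-> some_equality q a1 a2 a3 a4 a5)) /\
  ((Weil q 5 h /\ has_real_root h) <-> (caseI q h \/ caseII q h)) /\
  ~ (caseI q h /\ caseII q h).
Proof.
move=> p_prime k_gt0 q h; have q_gt0 : (0 < q)%N by rewrite expn_gt0 prime_gt0.
split; first exact: S_all_realP.
split; first exact: X_all_realP.
split; first exact: Weil_condsP.
split.
  move=> /(Weil_fpolyP _ _ _ _ _ q_gt0)[ys [sys ysb fE]].
  by rewrite (has_real_root_extremal q_gt0 sys ysb fE)
             (some_equality_extremal sys ysb fE).
split; first exact: Weil_real_root_casesP.
by case=> [[m [qE _]] [qN _]]; apply: qN; exists m.
Qed.
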